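(* Let $A$ be a split regular BiHom-Poisson superalgebra with respect to $H$, with root system $\Lambda$. Then $$A=U+\sum_{[\alpha]\in\Lambda/\sim}I_{[\alpha]},$$ where $U$ is a linear complement in $H$ of $\mathrm{span}_{\mathbb K}\{[A_{\alpha\psi^{-1}},A_{-\alpha\phi^{-1}}]+A_{\alpha\psi^{-1}}A_{-\alpha\phi^{-1}}:\alpha\in\Lambda\}$, each $I_{[\alpha]}=I_{H,[\alpha]}\oplus V_{[\alpha]}$ is an ideal of $A$, and $[I_{[\alpha]},I_{[\beta]}]+I_{[\alpha]}I_{[\beta]}=0$ whenever $[\alpha]\neq[\beta]$.
   Context: All algebras are of arbitrary dimension over an arbitrary field $\mathbb K$; $\mathbb N$ is the set of nonnegative integers. For subspaces $X,Y$, $[X,Y]$ and $XY$ denote the linear spans of all $[x,y]$, resp. $xy$. BiHom-Lie superalgebra: a $\mathbb Z_2$-graded space $A=A_{\bar 0}\oplus A_{\bar 1}$ with an even bilinear bracket $[\cdot,\cdot]$ ($[A_{\bar i},A_{\bar j}]\subset A_{\bar i+\bar j}$) and two (even) algebra homomorphisms $\phi,\psi:A\to A$ such that, for $x\in A_{\bar i},y\in A_{\bar j},z\in A_{\bar k}$: $\phi\psi=\psi\phi$; $[\psi(x),\phi(y)]=-(-1)^{\bar i\bar j}[\psi(y),\phi(x)]$; and $(-1)^{\bar k\bar i}[\psi^2(x),[\psi(y),\phi(z)]]+(-1)^{\bar i\bar j}[\psi^2(y),[\psi(z),\phi(x)]]+(-1)^{\bar j\bar k}[\psi^2(z),[\psi(x),\phi(y)]]=0$.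 BiHom-Poisson superalgebra: a BiHom-Lie superalgebra $(A,[\cdot,\cdot],\phi,\psi)$ with an even bilinear product, written by juxtaposition, such that $\phi$ and $\psi$ are multiplicative for it, $\phi(x)(yz)=(xy)\psi(z)$ for all $x,y,z$, and $[xy,\phi\psi(z)]=\phi(x)[y,\phi(z)]+(-1)^{\bar j\bar k}[x,\psi(z)]\phi(y)$ for $x\in A_{\bar i},y\in A_{\bar j},z\in A_{\bar k}$. It is regular if $\phi,\psi$ are bijective (automorphisms for both products). A subalgebra is a graded subspace $H=H_{\bar 0}\oplus H_{\bar 1}$ with $[H,H]+HH\subset H$ and $\phi(H)=\psi(H)=H$; it is abelian if $[H,H]=0$. An ideal is a graded subspace $I$ with $[I,A]+IA+AI\subset I$ and $\phi(I)=\psi(I)=I$. Let $H$ be a maximal abelian subalgebra of $A$. For a linear functional $\alpha:H_{\bar 0}\to\mathbb K$ put $A_\alpha=\{v\in A:[h,\phi(v)]=\alpha(h)\phi\psi(v)\ \text{for all } h\in H_{\bar 0}\}$, and $\Lambda=\{\alpha\in (H_{\bar 0})^*\setminus\{0\}:A_\alpha\neq 0\}$ (the roots, or root system). $A$ is a split regular BiHom-Poisson superalgebra with respect to $H$ if $A$ is a regular BiHom-Poisson superalgebra and $A=H\oplus\bigoplus_{\alpha\in\Lambda}A_\alpha$. For $p,q\in\mathbb Z$, $\alpha\phi^{p}\psi^{q}$ is the composition of $\alpha$ with $\phi^p\psi^q|_{H_{\bar 0}}$; $\pm\Lambda=\Lambda\cup(-\Lambda)$. Connections: for $\alpha,\beta\in\Lambda$,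 $\alpha$ is connected to $\beta$ (written $\alpha\sim\beta$) if either $\beta=\epsilon\alpha\phi^{z_1}\psi^{z_2}$ for some $z_1,z_2\in\mathbb Z$, $\epsilon\in\{-1,1\}$, or there is a list $\alpha_1,\dots,\alpha_k\in\pm\Lambda$, $k\ge 2$, such that, with $\sigma_i=\alpha_1\phi^{-i+1}+\sum_{j=2}^{i}\alpha_j\phi^{-i+j}\psi^{-1}$: (1) $\alpha_1\in\{\alpha\phi^{-n}\psi^{-r}:n,r\in\mathbb N\}$; (2) $\sigma_i\in\pm\Lambda$ for $2\le i\le k-1$; (3) $\sigma_k\in\{\pm\beta\phi^{-m}\psi^{-s}:m,s\in\mathbb N\}$. The relation $\sim$ is an equivalence relation on $\Lambda$; $[\alpha]$ denotes the class of $\alpha$. For $[\alpha]\in\Lambda/\sim$: $I_{H,[\alpha]}=\mathrm{span}_{\mathbb K}\{[A_{\beta\psi^{-1}},A_{-\beta\phi^{-1}}]+A_{\beta\psi^{-1}}A_{-\beta\phi^{-1}}:\beta\in[\alpha]\}$, $V_{[\alpha]}=\bigoplus_{\beta\in[\alpha]}A_\beta$, and $I_{[\alpha]}=I_{H,[\alpha]}\oplus V_{[\alpha]}$. *)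

(* Defs.v *)
From HB Require Import structures.
From mathcomp Require Import all_boot all_order all_algebra.
From mathcomp Require Import boolp classical_sets functions.
Set Implicit Arguments.
Unset Strict Implicit.
Unset Printing Implicit Defensive.
Import GRing.Theory.
Local Open Scope classical_set_scope.
Local Open Scope ring_scope.

Section LinearAlgebra.
Variables (K : fieldType) (A : lmodType K).
Implicit Types (S X Y : set A).

Definition lspan S : set A :=
  [set x | exists n (c : 'I_n -> K) (v : 'I_n -> A),
     (forall i, S (v i)) /\ x = \sum_(i < n) c i *: v i].

Definition addS X Y : set A := [set x + y | x in X & y in Y].

(* The sum of the subspaces F i, i in D. *)
Definition sumS (I : Type) (D : set I) (F : I -> set A) : set A :=
  lspan (\bigcup_(i in D) F i).

Definition indep2 X Y : Prop := X `&` Y = [set 0].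

Definition indep_family (I : Type) (D : set I) (F : I -> set A) : Prop :=
  forall i, D i -> indep2 (F i) (sumS (D `\ i) F).

(* X is a linear complement of Y in Z. *)
Definition is_complement X Y Z : Prop :=
  [/\ submod_closed (mem X), indep2 X Y & addS X Y = Z].

Definition prodS (op : A -> A -> A) X Y : set A :=
  lspan [set op x y | x in X & y in Y].

(* Integer powers of a self-map.  Negative powers use the partial inverse of
   the library, which is the inverse whenever f is bijective. *)
Definition zpow (f : A -> A) (z : int) : A -> A :=
  match z with
  | Posz n => iter n f
  | Negz n => iter n.+1 ('pinv_(fun=> 0) setT f)
  end.

End LinearAlgebra.

(* The vector space underlying a subspace. *)
Record sub_of (K : fieldType) (A : lmodType K) (S : submodClosed A) :=
  SubOf { sub_val : A; _ : sub_val \in S }.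

Section SubOf.
Variables (K : fieldType) (A : lmodType K) (S : submodClosed A).
HB.instance Definition _ := [isSub of sub_of S for @sub_val K A S].
HB.instance Definition _ := [Choice of sub_of S by <:].
HB.instance Definition _ := [SubChoice_isSubLmodule of sub_of S by <:].
End SubOf.

(* The group Z_2 is (bool, addb): gr false is the even part, gr true the odd
   part, and the parity product ij is i && j. *)
Record bihom_lie_superalgebra (K : fieldType) (A : lmodType K) := BiHomLie {
  gr : bool -> submodClosed A;
  br : {bilinear A -> A -> A};
  phi : {linear A -> A};
  psi : {linear A -> A};
  gr_indep : indep2 [set` gr false] [set` gr true];
  gr_sum : addS [set` gr false] [set` gr true] = setT;
  br_even : forall i j x y, x \in gr i -> y \in gr j -> br x y \in gr (i (+) j);
  phi_even : forall i x, x \in gr i -> phi x \in gr i;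
  psi_even : forall i x, x \in gr i -> psi x \in gr i;
  phi_br : forall x y, phi (br x y) = br (phi x) (phi y);
  psi_br : forall x y, psi (br x y) = br (psi x) (psi y);
  phi_psi : forall x, phi (psi x) = psi (phi x);
  br_skew : forall i j x y, x \in gr i -> y \in gr j ->
    br (psi x) (phi y) = - ((-1) ^+ (i && j) *: br (psi y) (phi x));
  br_jacobi : forall i j k x y z, x \in gr i -> y \in gr j -> z \in gr k ->
    (-1) ^+ (k && i) *: br (psi (psi x)) (br (psi y) (phi z))
    + (-1) ^+ (i && j) *: br (psi (psi y)) (br (psi z) (phi x))
    + (-1) ^+ (j && k) *: br (psi (psi z)) (br (psi x) (phi y)) = 0
}.

Record bihom_poisson_superalgebra (K : fieldType) (A : lmodType K) :=
  BiHomPoisson {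
  bihom_lie :> bihom_lie_superalgebra A;
  mul : {bilinear A -> A -> A};
  mul_even : forall i j x y,
    x \in gr bihom_lie i -> y \in gr bihom_lie j ->
    mul x y \in gr bihom_lie (i (+) j);
  phi_mul : forall x y,
    phi bihom_lie (mul x y) = mul (phi bihom_lie x) (phi bihom_lie y);
  psi_mul : forall x y,
    psi bihom_lie (mul x y) = mul (psi bihom_lie x) (psi bihom_lie y);
  mul_assoc : forall x y z,
    mul (phi bihom_lie x) (mul y z) = mul (mul x y) (psi bihom_lie z);
  br_mul : forall i j k x y z,
    x \in gr bihom_lie i -> y \in gr bihom_lie j -> z \in gr bihom_lie k ->
    br bihom_lie (mul x y) (phi bihom_lie (psi bihom_lie z)) =
      mul (phi bihom_lie x) (br bihom_lie y (phi bihom_lie z))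
      + (-1) ^+ (j && k) *:
          mul (br bihom_lie x (psi bihom_lie z)) (phi bihom_lie y)
}.

Section Poisson.
Variables (K : fieldType) (A : lmodType K) (P : bihom_poisson_superalgebra A).

Local Notation gr := (gr P).
Local Notation phi := (phi P).
Local Notation psi := (psi P).

Definition regular : Prop := bijective phi /\ bijective psi.

Definition brS (X Y : set A) : set A := prodS (br P) X Y.
Definition mulS (X Y : set A) : set A := prodS (mul P) X Y.

Definition graded_subspace (X : set A) : Prop :=
  submod_closed (mem X) /\
  X = addS (X `&` [set` gr false]) (X `&` [set` gr true]).

Definition subalgebra (H : set A) : Prop :=
  [/\ graded_subspace H, addS (brS H H) (mulS H H) `<=` H,
      phi @` H = H & psi @` H = H].

Definition ideal (I : set A) : Prop :=
  [/\ graded_subspace I,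
      addS (addS (brS I setT) (mulS I setT)) (mulS setT I) `<=` I,
      phi @` I = I & psi @` I = I].

Definition abelian_subalgebra (H : set A) : Prop :=
  subalgebra H /\ brS H H = [set 0].

Definition maximal_abelian_subalgebra (H : set A) : Prop :=
  abelian_subalgebra H /\
  forall H' : set A, abelian_subalgebra H' -> H `<=` H' -> H' = H.

Section Roots.
Variable H : submodClosed A.

Definition even_part : {pred A} := [pred x | (x \in H) && (x \in gr false)].

Fact even_part_submod_closed : submod_closed even_part.
Proof.
split; first by rewrite inE !rpred0.
move=> a x y /andP[xH x0] /andP[yH y0].
by rewrite inE !rpredD ?rpredZ.
Qed.
HB.instance Definition _ :=
  GRing.isSubmodClosed.Build K A even_part even_part_submod_closed.

Local Notation H0 := (sub_of even_part).

(* Linear functionals on H0 are the functions satisfying [scalar]; functions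
   into K are added, negated and compared (extensionally) pointwise. *)
Local Notation dual := (H0 -> K).

(* alpha \o (phi^p \o psi^q) restricted to H0.  As H0 is stable under phi^p and
   psi^q when phi and psi are bijective and phi @` H = psi @` H = H, the default
   value 0 of insubd is then never used. *)
Definition twist (alpha : dual) (p q : int) : dual :=
  fun h => alpha (insubd (0 : H0) (zpow phi p (zpow psi q (val h)))).

Definition root_space (alpha : dual) : set A :=
  [set v | forall h : H0, br P (val h) (phi v) = alpha h *: phi (psi v)].

Definition root_system : set dual :=
  [set alpha | [/\ scalar alpha, alpha <> 0 & root_space alpha <> [set 0]]].

Definition pm_root_system : set dual :=
  [set alpha | root_system alpha \/ root_system (- alpha)].

Definition split_regular : Prop :=
  [/\ regular,
      maximal_abelian_subalgebra [set` H],
      indep_family root_system root_space,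
      indep2 [set` H] (sumS root_system root_space) &
      addS [set` H] (sumS root_system root_space) = setT].

(* sigma s i is sigma_i for the list s = (alpha_1, ..., alpha_k); alpha_j is the
   entry of s of index j.-1. *)
Definition sigma (s : seq dual) (i : nat) : dual :=
  twist (nth 0 s 0) (1 - i%:Z) 0
  + \sum_(2 <= j < i.+1) twist (nth 0 s j.-1) (j%:Z - i%:Z) (-1).

Definition connection (alpha beta : dual) (s : seq dual) : Prop :=
  [/\ (2 <= size s)%N,
      forall j, (j < size s)%N -> pm_root_system (nth 0 s j),
      exists n r : nat, nth 0 s 0 = twist alpha (- n%:Z) (- r%:Z),
      forall i, (2 <= i <= (size s).-1)%N -> pm_root_system (sigma s i) &
      exists m r : nat,
        sigma s (size s) = twist beta (- m%:Z) (- r%:Z) \/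
        sigma s (size s) = - twist beta (- m%:Z) (- r%:Z)].

Definition connected (alpha beta : dual) : Prop :=
  (exists z1 z2 : int,
     beta = twist alpha z1 z2 \/ beta = - twist alpha z1 z2) \/
  exists s : seq dual, connection alpha beta s.

Definition root_class (alpha : dual) : set dual :=
  [set beta | root_system beta /\ connected alpha beta].

Definition root_classes : set (set dual) :=
  [set root_class alpha | alpha in root_system].

(* The sum over beta in c of
   [A_{beta psi^-1}, A_{- beta phi^-1}] + A_{beta psi^-1} A_{- beta phi^-1}. *)
Definition class_H (c : set dual) : set A :=
  sumS c (fun beta =>
    addS (brS (root_space (twist beta 0 (-1)))
              (root_space (- twist beta (-1) 0)))
         (mulS (root_space (twist beta 0 (-1)))
               (root_space (- twist beta (-1) 0)))).

Definition class_V (c : set dual) : set A := sumS c root_space.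

Definition class_I (c : set dual) : set A := addS (class_H c) (class_V c).

End Roots.
End Poisson.

Arguments root_system {K A} P H _.
Arguments root_classes {K A} P H _.
Arguments root_space {K A P H} alpha _.
Arguments class_I {K A P H} c _.

(* Main.v *)
Require Import Defs.
From HB Require Import structures.
From mathcomp Require Import all_boot all_order all_algebra.
From mathcomp Require Import zify.
From mathcomp Require Import boolp classical_sets functions.
Set Implicit Arguments.
Unset Strict Implicit.
Unset Printing Implicit Defensive.
Import GRing.Theory.
Local Open Scope classical_set_scope.
Local Open Scope ring_scope.

(** Write a(p,q) for the functional a twisted by phi^p psi^q.  The bracket and the
    product behave alike with respect to weights: both send A_a x A_b into
    A_c with c = a(-1,0) + b(0,-1) (lemma root_space_op), and phi^p psi^q sends A_a
    onto A_a(-p,-q).  The weight space of 0 is exactly H (root_space0_H), so A is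
    spanned by the weight spaces of 0 and of the roots (weight_ind).

    Connections are used only through the sets they cannot leave.  Call a set S of
    elements of Lambda and -Lambda saturated when it is closed under twists,
    signs, and the addition of any b in Lambda or -Lambda whose result stays in
    Lambda or -Lambda.  Each step of a connection is a twist followed by such an
    addition, and conversely the ends of the connections that start at a form a
    saturated set; hence the class of a consists of the roots in the least
    saturated set containing a (root_classE).  The complement of a saturated set
    is saturated, so two least saturated sets coincide or are disjoint.

    Fix a saturated S, and let H_S + V_S be the space attached to the roots in S.
    A product of A_a, a in S, with A_d has a weight that is zero, or a root, or
    neither: it lies in H_S, in V_S, or vanishes.  If d is outside S the first two
    cases would force d into S, so A_d annihilates the root spaces of S
    (root_annihilator).  What remains concerns a product or bracket of x and y, from
    root spaces of S with weights cancelling, with a third element v.  Each of the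
    four combinations of the operations is rewritten, by associativity, by the
    Leibniz rule, by the Leibniz rule read backwards, or by the Jacobi identity, as
    a combination of iterated products in which v is first multiplied by a twist of
    one of x, y, and the result by a twist of the other (op_op_l, op_op_r).  If v annihilates the root spaces of S, everything vanishes,
    so annihilators of V_S annihilate H_S; applied twice, this also gives
    H_S H_S' = 0 for disjoint S and S'.  If v is in H, the two factors of each term
    still lie in root spaces of S with cancelling weights, so the term lies in H_S.
    Hence H_S + V_S is an ideal, and disjoint saturated sets give ideals with zero
    product. *)

(** * Subspaces, spans and linear complements *)

Section Subspaces.
Variables (K : fieldType) (A : lmodType K).
Implicit Types (S X Y Z W : set A).

Definition subspace X : Prop :=
  X 0 /\ forall a x y, X x -> X y -> X (a *: x + y).

Lemma subspace_submod X : subspace X <-> submod_closed (mem X).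
Proof.
split=> -[X0 Xl]; split; first by rewrite inE.
- by move=> a x y; rewrite !inE; apply: Xl.
- by rewrite inE in X0.
- by move=> a x y Xx Xy; have := Xl a x y; rewrite !inE; apply.
Qed.

Lemma subspace_of_submod (M : submodClosed A) : subspace [set` M].
Proof. by split=> [|a x y /= Mx My]; rewrite /= ?rpred0 // rpredD ?rpredZ. Qed.

Section Closure.
Variable X : set A.
Hypothesis sX : subspace X.

Lemma subspace0 : X 0. Proof. by case: sX. Qed.

Lemma subspaceD x y : X x -> X y -> X (x + y).
Proof. by move=> Xx Xy; rewrite -[x]scale1r; apply: sX.2. Qed.

Lemma subspaceZ a x : X x -> X (a *: x).
Proof. by move=> Xx; rewrite -[_ *: x]addr0; apply: sX.2 => //; exact: sX.1. Qed.

Lemma subspaceN x : X x -> X (- x).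
Proof. by rewrite -scaleN1r; apply: subspaceZ. Qed.

Lemma subspaceB x y : X x -> X y -> X (x - y).
Proof. by move=> Xx Xy; apply: subspaceD => //; apply: subspaceN. Qed.

Lemma subspace_sum n (v : 'I_n -> A) : (forall i, X (v i)) -> X (\sum_i v i).
Proof.
by move=> Xv; elim/big_ind: _ => // [|x y]; [exact: subspace0 | exact: subspaceD].
Qed.
End Closure.

Lemma subspace_set0 : subspace [set 0].
Proof. by split=> // a x y -> ->; rewrite /= scaler0 addr0. Qed.

Lemma subspace_setI X Y : subspace X -> subspace Y -> subspace (X `&` Y).
Proof.
move=> sX sY; split; first by split; apply: subspace0.
by move=> a x y [Xx Yx] [Xy Yy]; split; [apply: sX.2 | apply: sY.2].
Qed.

Lemma subspace_preimage (f : A -> A) X :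
  linear f -> subspace X -> subspace [set x | X (f x)].
Proof.
move=> lf sX; split; last by move=> a x y Xx Xy; rewrite /= lf; apply: sX.2.
have := lf (-1) 0 0; rewrite scaler0 addr0 scaleN1r addNr /= => ->.
exact: subspace0.
Qed.

Lemma subspace_addS X Y : subspace X -> subspace Y -> subspace (addS X Y).
Proof.
move=> sX sY; split.
  by exists 0; [exact: subspace0|exists 0; [exact: subspace0|rewrite addr0]].
move=> a _ _ [x Xx [y Yy <-]] [x' Xx' [y' Yy' <-]].
exists (a *: x + x'); first exact: sX.2.
by exists (a *: y + y'); [exact: sY.2 | rewrite scalerDr addrACA].
Qed.

Lemma addSl X Y : subspace Y -> X `<=` addS X Y.
Proof.
by move=> sY x Xx; exists x => //; exists 0; rewrite ?addr0 //; exact: subspace0.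
Qed.

Lemma addSr X Y : subspace X -> Y `<=` addS X Y.
Proof. by move=> sX y Yy; exists 0; [exact: subspace0 | exists y; rewrite ?add0r]. Qed.

Lemma addS_sub X Y Z : subspace Z -> X `<=` Z -> Y `<=` Z -> addS X Y `<=` Z.
Proof.
by move=> sZ XZ YZ _ [x /XZ Zx [y /YZ Zy <-]]; apply: subspaceD.
Qed.

Lemma sub_lspan S : S `<=` lspan S.
Proof.
move=> x Sx; exists 1, (fun=> 1), (fun=> x); split=> //.
by rewrite big_ord1 scale1r.
Qed.

Lemma subspace_lspan S : subspace (lspan S).
Proof.
split; first by exists 0, (fun=> 0), (fun=> 0); rewrite big_ord0; split=> // -[].
move=> a _ _ [n [c [v [Sv ->]]]] [m [d [w [Sw ->]]]].
exists (n + m),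
  (fun i => match fintype.split i with inl j => a * c j | inr j => d j end),
  (fun i => match fintype.split i with inl j => v j | inr j => w j end); split.
  by move=> i; case: (fintype.split i).
rewrite big_split_ord /= scaler_sumr; congr (_ + _); apply: eq_bigr => i _.
  by rewrite (unsplitK (inl i)) scalerA.
by rewrite (unsplitK (inr i)).
Qed.

Lemma lspan_sub S Z : subspace Z -> S `<=` Z -> lspan S `<=` Z.
Proof.
move=> sZ SZ _ [n [c [v [Sv ->]]]]; apply: subspace_sum => // i.
by apply: subspaceZ => //; apply: SZ.
Qed.

Section Families.
Variables (I : Type) (D : set I) (F : I -> set A).

Lemma subspace_sumS : subspace (sumS D F).
Proof. exact: subspace_lspan. Qed.

Lemma sub_sumS i : D i -> F i `<=` sumS D F.
Proof. by move=> Di x Fx; apply: sub_lspan; exists i. Qed.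

Lemma sumS_sub Z :
  subspace Z -> (forall i, D i -> F i `<=` Z) -> sumS D F `<=` Z.
Proof. by move=> sZ FZ; apply: lspan_sub => // x [i Di]; apply: FZ. Qed.
End Families.

Lemma indep2E X Y :
  subspace X -> subspace Y -> indep2 X Y <-> forall x, X x -> Y x -> x = 0.
Proof.
move=> sX sY; split=> [XY x Xx Yx|XY].
  by have : (X `&` Y) x by []; rewrite XY.
apply/seteqP; split=> [x [Xx Yx]|_ ->]; first exact: XY.
by split; apply: subspace0.
Qed.

Lemma prodS_sub (op : A -> A -> A) X Y Z : subspace Z ->
  (forall x y, X x -> Y y -> Z (op x y)) -> prodS op X Y `<=` Z.
Proof. by move=> sZ opZ; apply: lspan_sub => // _ [x Xx [y Yy <-]]; apply: opZ. Qed.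

(** Zorn's lemma yields a maximal set that is closed under linear combinations
    and meets the given subspace only in the zero vector; a vector outside the
    sum of the two could be adjoined to it.  Closure is asked without containing
    the zero vector, so that the empty chain is covered as well. *)
Lemma ex_complement W Z :
  subspace W -> subspace Z -> W `<=` Z -> exists U, is_complement U W Z.
Proof.
move=> sW sZ WZ.
pose ok X := [/\ forall a x y, X x -> X y -> X (a *: x + y), X `<=` Z
  & forall x, X x -> W x -> x = 0].
have [|U [[Ul UZ UW] Umax]] := @Zorn_bigcup A ok.
  move=> F okF totF; split.
  - move=> a x y [X FX Xx] [Y FY Yy].
    have [XY|YX] := totF _ _ FX FY.
      by exists Y => //; have [+ _ _] := okF _ FY; apply=> //; apply: XY.
    by exists X => //; have [+ _ _] := okF _ FX; apply=> //; apply: YX.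
  - by move=> x [X FX]; have [_ + _] := okF _ FX; apply.
  - by move=> x [X FX]; have [_ _ +] := okF _ FX; apply.
have U0 : U 0.
  apply: contrapT => nU0.
  have UE x : U x -> False.
    by move=> Ux; apply: nU0; have := Ul (-1) _ _ Ux Ux; rewrite scaleN1r addNr.
  apply: (Umax [set 0]).
    by split=> [x /UE//|/(_ 0 erefl)].
  split; first by move=> a x y -> ->; rewrite /= scaler0 addr0.
  - by move=> _ ->; apply: subspace0.
  - by move=> x ->.
have sU : subspace U by split.
exists U; split; [exact: (subspace_submod U).1 | exact: (indep2E sU sW).2 |].
apply/seteqP; split; first exact: addS_sub.
move=> z Zz; apply: contrapT => nz.
pose L := [set k *: z | k in [set: K]].
have sL : subspace L.
  split; first by exists 0; rewrite ?scale0r.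
  move=> a _ _ [k _ <-] [l _ <-]; exists (a * k + l) => //.
  by rewrite scalerDl scalerA.
have Lz : L z by exists 1; rewrite ?scale1r.
apply: (Umax (addS U L)).
  split; first exact: addSl.
  move=> /(_ z (addSr sU Lz)) Uz; apply: nz; exact: addSl Uz.
split; first exact: (subspace_addS sU sL).2.
  by apply: addS_sub => // _ [k _ <-]; apply: subspaceZ.
move=> _ [x Ux [_ [k _ <-] <-]] Wx.
have [k0|k0] := eqVneq k 0.
  by move: Wx; rewrite k0 scale0r addr0; apply: UW.
case: nz; exists (- (k^-1 *: x)); first exact/(subspaceN sU)/(subspaceZ sU).
exists (k^-1 *: (x + k *: z)); first exact: subspaceZ.
by rewrite scalerDr scalerA mulVf // scale1r addKr.
Qed.

End Subspaces.

(** * Integer powers of a bijection *)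

Section IntegerPowers.
Variables (K : fieldType) (A : lmodType K) (f : A -> A).
Hypothesis bij_f : bijective f.

Lemma zpowNK : cancel f (zpow f (-1)).
Proof.
move=> x; apply: (@pinvKV _ _ _ setT f) => //; last by rewrite inE.
by move=> ? ? _ _; apply: (bij_inj bij_f).
Qed.

Lemma zpowKN : cancel (zpow f (-1)) f.
Proof.
move=> x; apply: (@pinvK _ _ _ setT f); rewrite inE.
by case: bij_f => g _ gK; exists (g x).
Qed.

Lemma zpowS p x : zpow f (p + 1) x = f (zpow f p x).
Proof.
case: p => [n|n]; first by rewrite -PoszD addn1.
have -> : Negz n + 1 = - n%:Z by rewrite NegzE intS opprD addrAC addNr add0r.
by case: n => [|n]; rewrite -?NegzE /= -/(zpow f (-1) _) zpowKN.
Qed.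

Lemma zpowB p x : zpow f (p - 1) x = zpow f (-1) (zpow f p x).
Proof. by rewrite -[in RHS](subrK 1 p) zpowS zpowNK. Qed.

Lemma zpowD p q x : zpow f (p + q) x = zpow f p (zpow f q x).
Proof.
elim/int_rect: p x => [|n IH|n IH] x; first by rewrite add0r.
  by rewrite intS [1 + _]addrC addrAC !zpowS IH.
by rewrite intS opprD [-1 - _]addrC addrAC !zpowB IH.
Qed.

Lemma zpow_ind (G : (A -> A) -> Prop) :
  G id -> (forall g, G g -> G (f \o g)) ->
  (forall g, G g -> G (zpow f (-1) \o g)) -> forall p, G (zpow f p).
Proof.
move=> G1 GS GB; elim/int_rect=> [//|n /GS|n /GB] G'.
  by rewrite intS addrC; rewrite (_ : zpow f _ = f \o zpow f n) //;
    apply/funext => x; rewrite zpowS.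
by rewrite intS opprD addrC; rewrite (_ : zpow f _ = zpow f (-1) \o zpow f (- n%:Z)) //;
    apply/funext => x; rewrite zpowB.
Qed.

End IntegerPowers.

(** * Weights *)

Section Weights.
Variables (K : fieldType) (A : lmodType K) (P : bihom_poisson_superalgebra A).
Variable H : submodClosed A.
Hypothesis splitP : split_regular P H.

Local Notation gr := (gr P).
Local Notation phi := (phi P).
Local Notation psi := (psi P).
Local Notation H0 := (sub_of (even_part P H)).
Local Notation dual := (H0 -> K).
Local Notation Lambda := (root_system P H).
Local Notation pmLambda := (@pm_root_system K A P H).

(** A name common to both operations: weights, annihilators and ideals treat the
    bracket and the product alike. *)
Definition op (b : bool) (x y : A) : A := if b then br P x y else Defs.mul P x y.

Lemma opDl b x y z : op b (x + y) z = op b x z + op b y z.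
Proof. by case: b; rewrite /op linearDl. Qed.
Lemma opDr b x y z : op b z (x + y) = op b z x + op b z y.
Proof. by case: b; rewrite /op linearDr. Qed.
Lemma opZl b a x z : op b (a *: x) z = a *: op b x z.
Proof. by case: b; rewrite /op linearZl_LR. Qed.
Lemma opZr b a x z : op b z (a *: x) = a *: op b z x.
Proof. by case: b; rewrite /op linearZr_LR. Qed.
Lemma op0l b z : op b 0 z = 0.
Proof. by case: b; rewrite /op linear0l. Qed.
Lemma op0r b z : op b z 0 = 0.
Proof. by case: b; rewrite /op linear0r. Qed.

Lemma op_linearl b z : linear (op b ^~ z).
Proof. by move=> a x y; rewrite /= opDl opZl. Qed.
Lemma op_linearr b z : linear (op b z).
Proof. by move=> a x y; rewrite /= opDr opZr. Qed.

Lemma op_even b i j x y :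
  x \in gr i -> y \in gr j -> op b x y \in gr (i (+) j).
Proof. by case: b; [exact: br_even | exact: Defs.mul_even]. Qed.

Lemma phi_op b x y : phi (op b x y) = op b (phi x) (phi y).
Proof. by case: b; [exact: phi_br | exact: Defs.phi_mul]. Qed.
Lemma psi_op b x y : psi (op b x y) = op b (psi x) (psi y).
Proof. by case: b; [exact: psi_br | exact: Defs.psi_mul]. Qed.

Lemma bij_phi : bijective phi. Proof. by case: splitP => -[]. Qed.
Lemma bij_psi : bijective psi. Proof. by case: splitP => -[]. Qed.

Lemma phi_H : phi @` [set` H] = [set` H].
Proof. by case: splitP => _ [[[]]]. Qed.
Lemma psi_H : psi @` [set` H] = [set` H].
Proof. by case: splitP => _ [[[]]]. Qed.

Lemma br_HH x y : x \in H -> y \in H -> br P x y = 0.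
Proof.
move=> Hx Hy; have [_ [[_ HH] _] _ _ _] := splitP.
suff : brS P [set` H] [set` H] (br P x y) by rewrite HH.
by apply: sub_lspan; exists x => //; exists y.
Qed.

Lemma gr_split x : exists x0 x1, [/\ x0 \in gr false, x1 \in gr true & x = x0 + x1].
Proof.
have : [set: A] x by []; rewrite -(gr_sum P) => -[x0 ? [x1 ? <-]].
by exists x0, x1.
Qed.

Lemma gr_direct x0 x1 :
  x0 \in gr false -> x1 \in gr true -> x0 + x1 = 0 -> x0 = 0 /\ x1 = 0.
Proof.
move=> g0 g1 /eqP; rewrite addr_eq0 => /eqP E.
have x00 : x0 = 0.
  apply: ((indep2E (subspace_of_submod _) (subspace_of_submod _)).1 (gr_indep P)) => //.
  by rewrite E; apply: (subspaceN (subspace_of_submod _)).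
by split=> //; apply/eqP; rewrite -oppr_eq0 -E x00.
Qed.

Definition homog_sums (X : set A) : set A := [set x | exists x0 x1,
  [/\ X x0, X x1, x0 \in gr false, x1 \in gr true & x = x0 + x1]].

Definition graded (X : set A) : Prop := X `<=` homog_sums X.

Lemma subspace_homog_sums X : subspace X -> subspace (homog_sums X).
Proof.
move=> sX; split.
  by exists 0, 0; rewrite !rpred0 addr0; split=> //; exact: subspace0.
move=> a _ _ [x0 [x1 [? ? ? ? ->]]] [y0 [y1 [? ? ? ? ->]]].
exists (a *: x0 + y0), (a *: x1 + y1); rewrite !rpredD ?rpredZ //.
by split=> //; [exact: sX.2 | exact: sX.2 | rewrite scalerDr addrACA].
Qed.

Lemma homog_homog_sums X i x :
  subspace X -> X x -> x \in gr i -> homog_sums X x.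
Proof.
move=> /subspace0 X0 Xx; case: i => gx.
  by exists 0, x; rewrite add0r rpred0.
by exists x, 0; rewrite addr0 rpred0.
Qed.

Lemma graded_ind X (Q : A -> Prop) : graded X ->
  (forall x y, Q x -> Q y -> Q (x + y)) ->
  (forall i x, X x -> x \in gr i -> Q x) -> forall x, X x -> Q x.
Proof.
move=> gX QD Qh x /gX [x0 [x1 [X0 X1 g0 g1 ->]]].
by apply: QD; apply: Qh; eassumption.
Qed.

Lemma graded_lspan S : graded S -> graded (lspan S).
Proof.
move=> gS; apply: lspan_sub => [|x /gS [x0 [x1 [? ? ? ? ->]]]].
  exact/subspace_homog_sums/subspace_lspan.
by exists x0, x1; split=> //; apply: sub_lspan.
Qed.

Lemma graded_addS X Y : graded X -> graded Y -> graded (addS X Y).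
Proof.
move=> gX gY _ [x /gX [x0 [x1 [? ? ? ? ->]]] [y /gY [y0 [y1 [? ? ? ? ->]]] <-]].
exists (x0 + y0), (x1 + y1); rewrite !rpredD //; split=> //; last by rewrite addrACA.
  by exists x0 => //; exists y0.
by exists x1 => //; exists y1.
Qed.

Lemma graded_bigcup I (D : set I) (F : I -> set A) :
  (forall i, D i -> graded (F i)) -> graded (\bigcup_(i in D) F i).
Proof.
move=> gF x [i Di /(gF _ Di) [x0 [x1 [? ? ? ? ->]]]].
by exists x0, x1; split=> //; exists i.
Qed.

Lemma graded_subspaceP X : subspace X -> graded X -> graded_subspace P X.
Proof.
move=> sX gX; split; first exact: (subspace_submod X).1.
apply/seteqP; split; last by apply: addS_sub => // x [].
by move=> x /gX [x0 [x1 [? ? ? ? ->]]]; exists x0 => //; exists x1.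
Qed.

Lemma graded_prodS b X Y : graded X -> graded Y -> graded (prodS (op b) X Y).
Proof.
move=> gX gY.
have sZ := subspace_homog_sums (subspace_lspan [set op b x y | x in X & y in Y]).
apply: lspan_sub => // _ [x Xx [y Yy <-]].
move: x Xx; apply: (graded_ind gX) => [x x'|i x Xx gx].
  by rewrite opDl; apply: subspaceD.
move: y Yy; apply: (graded_ind gY) => [y y'|j y Yy gy].
  by rewrite opDr; apply: subspaceD.
apply: homog_homog_sums (op_even b gx gy); first exact: subspace_lspan.
by apply: sub_lspan; exists x => //; exists y.
Qed.

(** Closure under composition and inverses carries these properties from phi and psi
    to all the maps phi^p psi^q at once. *)
Definition symmetry (F : A -> A) : Prop :=
  [/\ linear F, forall b x y, F (op b x y) = op b (F x) (F y),
      forall i x, x \in gr i -> F x \in gr i, forall x, x \in H -> F x \in H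
    & (forall x, F (phi x) = phi (F x)) /\ forall x, F (psi x) = psi (F x)].

Lemma symmetry_id : symmetry id. Proof. by []. Qed.

Lemma symmetry_comp F G : symmetry F -> symmetry G -> symmetry (F \o G).
Proof.
move=> [lF oF gF HF [F1 F2]] [lG oG gG HG [G1 G2]]; split=> /=.
- by move=> a x y; rewrite /= lG lF.
- by move=> b x y; rewrite oG oF.
- by move=> i x /gG /gF.
- by move=> x /HG /HF.
- by split=> x; rewrite (G1, G2) (F1, F2).
Qed.

Lemma symmetry_phi : symmetry phi.
Proof.
split=> //; first by move=> a x y; rewrite linearP.
- exact: phi_op.
- exact: phi_even.
- move=> x Hx; suff : [set` H] (phi x) by [].
  by rewrite -phi_H; exists x.
- by split=> // x; rewrite phi_psi.
Qed.

Lemma symmetry_psi : symmetry psi.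
Proof.
split=> //; first by move=> a x y; rewrite linearP.
- exact: psi_op.
- exact: psi_even.
- move=> x Hx; suff : [set` H] (psi x) by [].
  by rewrite -psi_H; exists x.
- by split=> // x; rewrite phi_psi.
Qed.

(** An inverse respects the grading because the components of the inverse image of a
    homogeneous element are mapped to components of that element. *)
Lemma symmetry_inv F G : symmetry F -> cancel F G -> cancel G F ->
  F @` [set` H] = [set` H] -> symmetry G.
Proof.
move=> [lF oF gF HF [F1 F2]] FK GK FH; have injF := can_inj FK.
have F0 : F 0 = 0.
  by have := lF (-1) 0 0; rewrite scaler0 addr0 scaleN1r addNr.
split.
- by move=> a x y; apply: injF; rewrite lF !GK.
- by move=> b x y; apply: injF; rewrite oF !GK.
- move=> i x gx; have [y0 [y1 [g0 g1 E]]] := gr_split (G x).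
  have FE : x = F y0 + F y1.
    by rewrite -[in LHS](GK x) E -[y0 in LHS]scale1r lF scale1r.
  rewrite E; case: i gx => gx.
    have [] := @gr_direct (F y0) (F y1 - x).
    + exact: gF.
    + by apply: (subspaceB (subspace_of_submod _)) => //; apply: gF.
    + by rewrite addrA -FE subrr.
    by move=> Fy0 _; rewrite (injF y0 0) ?F0 ?add0r.
  have [] := @gr_direct (F y0 - x) (F y1).
  + by apply: (subspaceB (subspace_of_submod _)) => //; apply: gF.
  + exact: gF.
  + by rewrite addrAC -FE subrr.
  by move=> _ Fy1; rewrite (injF y1 0) ?F0 ?addr0.
- move=> x Hx; have : [set` H] x by [].
  by rewrite -FH => -[y Hy <-]; rewrite FK.
- by split=> x; apply: injF; rewrite (F1, F2) !GK.
Qed.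

Lemma symmetry_zpow_phi p : symmetry (zpow phi p).
Proof.
apply: (zpow_ind bij_phi) => [|g|g]; first exact: symmetry_id.
  by apply: symmetry_comp; exact: symmetry_phi.
apply: symmetry_comp; apply: (symmetry_inv symmetry_phi _ _ phi_H).
  exact: zpowNK bij_phi.
exact: zpowKN bij_phi.
Qed.

Lemma symmetry_zpow_psi p : symmetry (zpow psi p).
Proof.
apply: (zpow_ind bij_psi) => [|g|g]; first exact: symmetry_id.
  by apply: symmetry_comp; exact: symmetry_psi.
apply: symmetry_comp; apply: (symmetry_inv symmetry_psi _ _ psi_H).
  exact: zpowNK bij_psi.
exact: zpowKN bij_psi.
Qed.

Definition shift (p q : int) (x : A) : A := zpow phi p (zpow psi q x).

Lemma symmetry_shift p q : symmetry (shift p q).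
Proof. exact: symmetry_comp (symmetry_zpow_phi p) (symmetry_zpow_psi q). Qed.

Lemma shift_op p q b x y : shift p q (op b x y) = op b (shift p q x) (shift p q y).
Proof. by case: (symmetry_shift p q). Qed.
Lemma shift_linear p q : linear (shift p q).
Proof. by case: (symmetry_shift p q). Qed.
Lemma shift_even p q i x : x \in gr i -> shift p q x \in gr i.
Proof. by case: (symmetry_shift p q) => _ _ + _ _; apply. Qed.
Lemma shift_H p q x : x \in H -> shift p q x \in H.
Proof. by case: (symmetry_shift p q) => _ _ _ + _; apply. Qed.

Lemma shift_shift p q p' q' x :
  shift p q (shift p' q' x) = shift (p + p') (q + q') x.
Proof.
have comm r y : zpow psi q (zpow phi r y) = zpow phi r (zpow psi q y).
  pose G g := forall z, zpow psi q (g z) = g (zpow psi q z).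
  apply: (@zpow_ind _ _ _ bij_phi G) => // g gE z /=.
    by have [_ _ _ _ [-> _]] := symmetry_zpow_psi q; rewrite gE.
  apply: (bij_inj bij_phi); have [_ _ _ _ [<- _]] := symmetry_zpow_psi q.
  by rewrite !(zpowKN bij_phi) gE.
by rewrite /shift comm -(zpowD bij_phi) -(zpowD bij_psi).
Qed.

Lemma shiftZ p q a x : shift p q (a *: x) = a *: shift p q x.
Proof.
have s0 : shift p q 0 = 0.
  by have := shift_linear p q (-1) 0 0; rewrite scaler0 addr0 scaleN1r addNr.
by rewrite -[a *: x]addr0 shift_linear s0 addr0.
Qed.

Lemma shiftNK p q : cancel (shift (- p) (- q)) (shift p q).
Proof. by move=> x; rewrite shift_shift !subrr. Qed.

Lemma shift_0 p q : shift p q 0 = 0.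
Proof. by rewrite -(scale0r 0) shiftZ !scale0r. Qed.

Lemma phiE x : phi x = shift 1 0 x. Proof. by []. Qed.
Lemma psiE x : psi x = shift 0 1 x. Proof. by []. Qed.

(** ** Twisting functionals *)

Fact shift_even_part p q (h : H0) : shift p q (val h) \in even_part P H.
Proof.
have /andP[Hh gh] : val h \in even_part P H := valP h.
by rewrite inE shift_H ?shift_even.
Qed.

Definition hshift p q (h : H0) : H0 := insubd 0 (shift p q (val h)).

Lemma val_hshift p q h : val (hshift p q h) = shift p q (val h).
Proof. by rewrite /hshift insubdK //; exact: shift_even_part. Qed.

Lemma hshift_hshift p q p' q' h :
  hshift p q (hshift p' q' h) = hshift (p + p') (q + q') h.
Proof. by apply: val_inj; rewrite !val_hshift shift_shift. Qed.

Lemma hshift00 h : hshift 0 0 h = h.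
Proof. by apply: val_inj; rewrite val_hshift. Qed.

Lemma hshift_linear p q : linear (hshift p q).
Proof.
move=> a x y; apply: val_inj; rewrite val_hshift.
by rewrite GRing.valD GRing.valZ shift_linear GRing.valD GRing.valZ !val_hshift.
Qed.

Lemma twistE (a : dual) p q h : twist a p q h = a (hshift p q h).
Proof. by []. Qed.

Lemma twist_twist (a : dual) p q p' q' :
  twist (twist a p q) p' q' = twist a (p + p') (q + q').
Proof. by apply/funext => h; rewrite !twistE hshift_hshift. Qed.

Lemma twist00 (a : dual) : twist a 0 0 = a.
Proof. by apply/funext => h; rewrite twistE hshift00. Qed.

Lemma twistD (a b : dual) p q : twist (a + b) p q = twist a p q + twist b p q.
Proof. by []. Qed.
Lemma twistN (a : dual) p q : twist (- a) p q = - twist a p q.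
Proof. by []. Qed.
Lemma twist0 p q : twist (0 : dual) p q = 0.
Proof. by []. Qed.

Lemma twist_scalar (a : dual) p q : scalar a -> scalar (twist a p q).
Proof. by move=> la k x y; rewrite !twistE hshift_linear la. Qed.

Lemma twist_eq0 (a : dual) p q : twist a p q = 0 -> a = 0.
Proof.
by move=> E; have := twist_twist a p q (- p) (- q); rewrite E !subrr twist00 => <-.
Qed.

(** ** Root spaces *)

Lemma subspace_root_space (a : dual) : subspace (root_space a).
Proof.
split=> [h|k x y ax ay h]; first by rewrite !linear0.
by rewrite !linearD !linearZ /= ax ay.
Qed.

Lemma even_H (h : H0) : val h \in H /\ val h \in gr false.
Proof. by have /andP := valP h. Qed.

Lemma graded_root_space (a : dual) : graded (root_space a).
Proof.
move=> v av; have [x0 [x1 [g0 g1 E]]] := gr_split v.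
suff D h : br P (val h) (phi x0) - a h *: phi (psi x0) = 0 /\
           br P (val h) (phi x1) - a h *: phi (psi x1) = 0.
  exists x0, x1; split=> // h; apply/eqP; rewrite -subr_eq0; apply/eqP.
    by case: (D h).
  by case: (D h).
have [_ gh] := even_H h.
apply: gr_direct.
- apply: (subspaceB (subspace_of_submod _)); first exact: (br_even gh (phi_even g0)).
  by apply: (subspaceZ (subspace_of_submod _)); apply/phi_even/psi_even.
- apply: (subspaceB (subspace_of_submod _)); first exact: (br_even gh (phi_even g1)).
  by apply: (subspaceZ (subspace_of_submod _)); apply/phi_even/psi_even.
apply/eqP; rewrite addrACA -opprD -scalerDr -linearDr -!linearD -E.
by rewrite subr_eq0 av.
Qed.

Lemma shift_phi p q x : shift p q (phi x) = phi (shift p q x).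
Proof. by rewrite !phiE !shift_shift addrC [q + 0]addrC. Qed.

Lemma shift_psi p q x : shift p q (psi x) = psi (shift p q x).
Proof. by rewrite !psiE !shift_shift addrC [q + 1]addrC. Qed.

(** The action of h on the image of x is the image of the action on x of the inverse
    image of h, so the functional is twisted by the inverse of phi^p psi^q. *)
Lemma root_space_shift (a : dual) p q x :
  root_space a x -> root_space (twist a (- p) (- q)) (shift p q x).
Proof.
move=> ax h; have := congr1 (shift p q) (ax (hshift (- p) (- q) h)).
by rewrite (shift_op p q true) shiftZ val_hshift shiftNK !(shift_phi, shift_psi).
Qed.

Lemma br_skew_even j (h : H0) y : y \in gr j ->
  br P (psi y) (phi (val h)) = - br P (psi (val h)) (phi y).
Proof.
have [_ gh] := even_H h => gy.
by rewrite (br_skew gy gh) andbF expr0 scale1r.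
Qed.

(** For the bracket this is the Jacobi identity with an element of H0 in the first
    place; for the product it is the Leibniz rule with an element of H0 in the last
    place, brought to the first place by skew-symmetry.  Both rules fix powers of phi
    and psi in front of their arguments, so h and x are replaced by suitable twists. *)
Lemma root_space_op b (a c : dual) x y : root_space a x -> root_space c y ->
  root_space (twist a (-1) 0 + twist c 0 (-1)) (op b x y).
Proof.
pose w := twist a (-1) 0 + twist c 0 (-1); have sw := subspace_root_space w.
move=> ax cy; move: x ax.
apply: (@graded_ind _ (fun x => root_space w (op b x y)) (@graded_root_space a)).
  by move=> x x' hx hx'; rewrite opDl; exact: (subspaceD sw hx hx').
move=> j x ax gx; move: y cy.
apply: (@graded_ind _ (fun y => root_space w (op b x y)) (@graded_root_space c)).
  by move=> y y' hy hy'; rewrite opDr; exact: (subspaceD sw hy hy').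
move=> k y cy gy h; rewrite /w addrfctE !twistE {w sw}.
have psi_val p u : psi (val (hshift p (-1) u)) = val (hshift p 0 u).
  by rewrite !val_hshift psiE shift_shift ?add0r.
have psi_val2 u : psi (val (hshift 0 (-2) u)) = val (hshift 0 (-1) u).
  by rewrite !val_hshift psiE shift_shift ?add0r.
have phi_val u : phi (val (hshift (-1) (-1) u)) = val (hshift 0 (-1) u).
  by rewrite !val_hshift phiE shift_shift.
rewrite -[in LHS](hshift00 h) -psi_val; case: b; rewrite /op; last first.
  apply: oppr_inj; rewrite -(br_skew_even _ (mul_even gx gy)) Defs.psi_mul -psi_val2.
  rewrite (br_mul (psi_even gx) (psi_even gy) (even_H _).2) andbF expr0 scale1r.
  rewrite (br_skew_even _ gy) psi_val2 cy -phi_val (br_skew_even _ gx) psi_val ax.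
  rewrite linearNr linearNl linearZr_LR linearZl_LR.
  by rewrite -opprD addrC -scalerDl !(Defs.phi_mul, Defs.psi_mul).
set h1 := hshift 0 (-1) h; set h2 := hshift 0 (-2) h.
(* With this twist of x the inner bracket of the Jacobi identity is that of phi x
   with phi y, the image of the bracket under study. *)
have gy' : shift 1 (-1) x \in gr j by apply: shift_even.
have J := br_jacobi (even_H h2).2 gy' gy.
have psi_x' : psi (shift 1 (-1) x) = phi x by rewrite psiE shift_shift.
have ax' := root_space_shift 1 (-1) ax.
rewrite !psi_val2 psi_x' in J.
move: J; rewrite !andbF expr0 !scale1r (br_skew_even _ gy) psi_val2 cy ax'.
have E1 : br P (psi (phi x)) (phi (psi y)) = psi (phi (br P x y)).
  by rewrite phi_br psi_br phi_psi.
have E2 : br P (psi (psi y)) (phi (psi (shift 1 (-1) x))) =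
    - ((-1) ^+ (k && j) *: psi (phi (br P x y))).
  by rewrite phi_psi -psi_br (br_skew gy gy') psi_x' linearN linearZ phi_br.
have E3 : hshift (-1) (- -1) (hshift 0 (-1) h) = hshift (-1) 0 h.
  by rewrite hshift_hshift.
rewrite linearNr !linearZr_LR E1 E2 twistE E3 -phi_br -phi_psi /h1 andbC => J.
apply/eqP; rewrite -subr_eq0 -[X in _ == X]J scalerDl opprD addrA addrAC.
rewrite scalerN scalerN !scalerA mulrC mulrA.
by rewrite -expr2 sqrr_sign mul1r addrAC.
Qed.

(** ** The zero weight space *)

Lemma H_root_space0 x : x \in H -> root_space (0 : dual) x.
Proof.
move=> Hx h; rewrite scale0r; apply: br_HH; first exact: (even_H h).1.
exact: (shift_H 1 0).
Qed.

(** Induction on the number n of weight vectors in a sum w that H0 centralises.  Choose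
    h on which the weight of the first vector does not vanish.  The action of h on w is
    zero, and subtracting a suitable multiple of it from w cancels the first vector
    while rescaling the others, so w is a sum of n - 1 weight vectors. *)
Lemma root_space0_sum w :
  root_space (0 : dual) w -> sumS Lambda root_space w -> w = 0.
Proof.
suff main n (v : 'I_n -> A) (a : 'I_n -> dual) :
    (forall i, Lambda (a i)) -> (forall i, root_space (a i) (v i)) ->
    root_space (0 : dual) (\sum_i v i) -> \sum_i v i = 0.
  move=> w0 [n [c [v [Sv E]]]]; move: w0; rewrite E.
  have [a aP] := @choice _ _ (fun i b => Lambda b /\ root_space b (v i))
    (fun i => let: ex_intro2 b Lb bv := Sv i in ex_intro _ b (conj Lb bv)).
  refine (main _ (fun i => c i *: v i) a _ _) => i; first exact: (aP i).1.
  exact: (subspaceZ (subspace_root_space _) _ (aP i).2).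
elim: n v a => [|n IH] v a La av; first by rewrite big_ord0.
have [h ah] : exists h, a ord0 h != 0.
  apply: contrapT => nh; case: (La ord0) => _ + _; apply; apply/funext => h.
  by apply/eqP; apply: contrapT => /negP ah; apply: nh; exists h.
move=> v0; have : \sum_i (a i h) *: v i = 0.
  apply/(bij_inj bij_psi)/(bij_inj bij_phi); rewrite !linear0.
  rewrite -[RHS](scale0r (phi (psi (\sum_i v i)))) -(v0 h) !linear_sum /=.
  by apply: eq_bigr => i _; rewrite !linearZ /= av.
move=> av0; have E : \sum_i v i = \sum_i (1 - (a ord0 h)^-1 * a i h) *: v i.
  under [RHS]eq_bigr do rewrite scalerBl scale1r -scalerA.
  by rewrite sumrB -scaler_sumr av0 scaler0 subr0.
move: v0; rewrite E big_ord_recl mulVf // subrr scale0r add0r => v0.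
refine (IH (fun i => (1 - (a ord0 h)^-1 * a (lift ord0 i) h) *: v (lift ord0 i))
  (fun i => a (lift ord0 i)) _ _ v0) => i //.
exact: (subspaceZ (subspace_root_space _) _ (av _)).
Qed.

Lemma weight_ind (Q : set A) : subspace Q ->
  (forall x, root_space (0 : dual) x -> Q x) ->
  (forall a x, Lambda a -> root_space a x -> Q x) -> forall x, Q x.
Proof.
move=> sQ Q0 Qa x; have [_ _ _ _ HV] := splitP.
have : [set: A] x by []; rewrite -HV; apply: addS_sub => // [y Hy|].
  exact/Q0/H_root_space0.
by apply: sumS_sub => // a La y; apply: Qa.
Qed.

(** The component outside H of an element of weight zero has weight zero too, so it
    vanishes. *)
Lemma root_space0_H x : root_space (0 : dual) x -> x \in H.
Proof.
move=> x0; have [_ _ _ _ HV] := splitP.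
have : [set: A] x by []; rewrite -HV => -[h Hh [w Vw E]].
suff -> : x = h by [].
rewrite -E [w](root_space0_sum _ Vw) ?addr0 //.
rewrite -[w](addKr h) E addrC; apply: subspaceB x0 _; first exact: subspace_root_space.
exact: H_root_space0.
Qed.

(** ** Roots *)

Lemma root_pm a : Lambda a -> pmLambda a. Proof. by left. Qed.

Lemma pmN a : pmLambda a -> pmLambda (- a).
Proof. by case=> ?; [right; rewrite opprK | left]. Qed.

Lemma scalarN (a : dual) : scalar a -> scalar (- a).
Proof. by move=> la k x y; rewrite !opprfctE la opprD mulrN. Qed.

Lemma scalarD (a b : dual) : scalar a -> scalar b -> scalar (a + b).
Proof. by move=> la lb k x y; rewrite !addrfctE la lb mulrDr addrACA. Qed.

Lemma pm_scalar a : pmLambda a -> scalar a.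
Proof. by case=> -[la _ _] //; rewrite -[a]opprK; apply: scalarN. Qed.

Lemma pm_neq0 a : pmLambda a -> a <> 0.
Proof. by case=> -[_ a0 _] // E; apply: a0; rewrite E oppr0. Qed.

Lemma root_twist a p q : Lambda a -> Lambda (twist a p q).
Proof.
move=> [la a0 aA]; split; first exact: twist_scalar.
  by move/twist_eq0.
move=> E; apply: aA; apply/seteqP; split; last first.
  by move=> _ ->; exact: (subspace0 (subspace_root_space a)).
move=> x /(root_space_shift (- p) (- q)); rewrite !opprK E => /= x0.
by rewrite -[x](shiftNK p q) x0 shift_0.
Qed.

Lemma pm_twist a p q : pmLambda a -> pmLambda (twist a p q).
Proof. by case=> /(root_twist p q); [left | right]. Qed.

Lemma weight_cases (a : dual) x : scalar a -> root_space a x ->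
  [\/ x = 0, a = 0 | Lambda a].
Proof.
move=> la ax; have [->|x0] := EM (x = 0); first by constructor 1.
have [->|a0] := EM (a = 0); first by constructor 2.
by constructor 3; split=> // E; apply: x0; rewrite E in ax.
Qed.

(** * Saturated sets of roots *)

(** The sets of elements of Lambda and -Lambda that no connection leaves: each of its
    steps is a twist followed by the addition of an element of Lambda or -Lambda. *)
Definition saturated (S : set dual) : Prop :=
  [/\ S `<=` pmLambda, forall a p q, S a -> S (twist a p q),
      forall a, S a -> S (- a)
    & forall a b, S a -> pmLambda b -> pmLambda (a + b) -> S (a + b)].

(** The least saturated set containing a, as the intersection of all of them. *)
Definition component (a : dual) : set dual :=
  [set b | pmLambda b /\ forall S, saturated S -> S a -> S b].

Lemma saturated_component a : saturated (component a).
Proof.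
split=> [b []//|b p q [pb Sb]|b [pb Sb]|b d [pb Sb] pd pbd].
- split; first exact: pm_twist.
  by move=> S sS Sa; have [_ + _ _] := sS; apply; apply: Sb.
- split; first exact: pmN.
  by move=> S sS Sa; have [_ _ + _] := sS; apply; apply: Sb.
- by split=> // S sS Sa; have [_ _ _ +] := sS; apply => //; apply: Sb.
Qed.

Lemma component_refl a : pmLambda a -> component a a.
Proof. by split. Qed.

(** Steps can be undone: from a + b one returns to a by adding -b. *)
Lemma saturatedD S : saturated S -> saturated (pmLambda `\` S).
Proof.
move=> [Spm St SN SD]; split=> [b []//|b p q [pb nb]|b [pb nb]|b d [pb nb] pd pbd].
- split; first exact: pm_twist.
  by move=> /(St _ (- p) (- q)); rewrite twist_twist !subrr twist00.
- by split; [exact: pmN | move=> /SN; rewrite opprK].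
- split=> // Sbd; apply: nb; rewrite -[b](addrK d); apply: SD => //.
    exact: pmN.
  by rewrite addrK.
Qed.

(** If a were not in the component of b, the complement of that component would be a
    saturated set containing a, hence containing b. *)
Lemma component_sym a b : pmLambda a -> component a b -> component b a.
Proof.
move=> pa [pb ab]; apply: contrapT => nba.
have [_] := ab _ (saturatedD (saturated_component b)) (conj pa nba).
by apply; apply: component_refl.
Qed.

Lemma component_eq a b : pmLambda a -> component a b -> component a = component b.
Proof.
move=> pa ab; have ba := component_sym pa ab.
apply/seteqP; split=> d [pd Sd]; split=> // S sS.
  by move=> Sb; apply: Sd => //; apply: ba.2.
by move=> Sa; apply: Sd => //; apply: ab.2.
Qed.

Lemma component_meet_eq a b d :
  pmLambda a -> pmLambda b -> component a d -> component b d ->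
  component a = component b.
Proof. by move=> pa pb /(component_eq pa) -> /(component_eq pb) ->. Qed.

(** * Rearranging a product of three factors *)

Section Rearrangement.
Variables (Z : set A) (i j k : bool) (a b v : A).
Hypotheses (sZ : subspace Z) (ga : a \in gr i) (gb : b \in gr j) (gv : v \in gr k).

Lemma subspace_signr n x : Z ((-1) ^+ n *: x) -> Z x.
Proof.
by move=> Zx; rewrite -[x]scale1r -(sqrr_sign _ n) expr2 -scalerA; apply: subspaceZ.
Qed.

Lemma jacobi_subspace m n p x y z :
  (-1) ^+ m *: x + (-1) ^+ n *: y + (-1) ^+ p *: z = 0 -> Z y -> Z z -> Z x.
Proof.
move=> E Zy Zz; apply: (@subspace_signr m).
have -> : (-1) ^+ m *: x = - ((-1) ^+ n *: y + (-1) ^+ p *: z).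
  by apply/eqP; rewrite -addr_eq0 addrA E.
by apply: subspaceN => //; apply: subspaceD => //; apply: subspaceZ.
Qed.

(** According to the two operations m and n on the left-hand side this is, for
    (bracket, bracket), the Jacobi identity; for (bracket, product), the Leibniz rule;
    for (product, bracket), the Leibniz rule solved for its last term; and for
    (product, product), associativity.  Stated for membership in a subspace Z, it
    serves both Z = 0 and Z = H_S. *)
Lemma op_op_l :
  (forall m n, Z (op m (shift 1 0 a) (op n b (shift 0 (-1) v)))) ->
  (forall m n, Z (op m (op n a (shift (-1) 0 v)) (shift 1 0 b))) ->
  (forall m n, Z (op m (shift 1 0 a) (op n (shift (-1) 0 v) (shift 1 (-1) b)))) ->
  (forall m n, Z (op m (shift 0 1 b) (op n (shift (-1) 0 v) (shift 2 (-2) a)))) ->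
  forall m n, Z (op m (op n a b) v).
Proof.
move=> Z1 Z2 Z3 Z4 [] [].
- have J := br_jacobi (shift_even (-1) (-1) gv) (shift_even 1 (-2) ga)
    (shift_even 0 (-1) gb).
  rewrite !(phiE, psiE, shift_shift) /= in J.
  have := jacobi_subspace J (Z1 true true) (Z4 true true).
  have -> : op true (op true a b) v =
      - ((-1) ^+ ((i (+) j) && k) *: br P (shift (-1) 1 v) (shift 1 (-1) (br P a b))).
    have := br_skew (shift_even 0 (-1) (br_even ga gb)) (shift_even (-1) 0 gv).
    by rewrite !(phiE, psiE, shift_shift).
  by rewrite (shift_op _ _ true) => ?; apply/(subspaceN sZ)/(subspaceZ sZ).
- have := br_mul ga gb (shift_even (-1) (-1) gv).
  rewrite !(phiE, psiE, shift_shift) /= => E; rewrite /op E.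
  apply: subspaceD => //; first exact: (Z1 false true).
  by apply: subspaceZ => //; exact: (Z2 false true).
- have := br_mul ga (shift_even (-1) 0 gv) (shift_even 0 (-1) gb).
  rewrite !(phiE, psiE, shift_shift) /= => E.
  apply: (@subspace_signr (k && j)).
  have -> : (-1) ^+ (k && j) *: op false (op true a b) v =
     op true (op false a (shift (-1) 0 v)) (shift 1 0 b) -
     op false (shift 1 0 a) (op true (shift (-1) 0 v) (shift 1 (-1) b)).
    by rewrite /op E addrAC subrr add0r.
  exact: subspaceB.
- have := mul_assoc P a b (shift 0 (-1) v).
  rewrite !(phiE, psiE, shift_shift) /= => E.
  by have := Z1 false false; rewrite /op E.
Qed.

(** The mirror image of the previous lemma.  It is not a formal consequence of it, the
    product being in general neither commutative nor skew-symmetric. *)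
Lemma op_op_r :
  (forall m n, Z (op m (op n (shift (-1) 0 v) a) (shift 0 1 b))) ->
  (forall m n, Z (op m (op n (shift (-1) 0 v) (shift (-1) 1 b)) (shift 1 0 a))) ->
  (forall m n, Z (op m (shift 0 1 a) (op n (shift (-1) 1 b) (shift 1 (-2) v)))) ->
  (forall m n, Z (op m (op n (shift (-1) 1 a) (shift 0 (-1) v)) (shift 0 1 b))) ->
  (forall m n, Z (op m (shift (-1) 2 b) (op n (shift 0 (-1) v) (shift 1 (-1) a)))) ->
  forall m n, Z (op m v (op n a b)).
Proof.
move=> Z1 Z2 Z3 Z4 Z5 [] [].
- have J := br_jacobi (shift_even 0 (-2) gv) (shift_even 0 (-1) ga)
    (shift_even (-1) 0 gb).
  rewrite !(phiE, psiE, shift_shift) /= in J.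
  exact: jacobi_subspace J (Z3 true true) (Z5 true true).
- have -> : op true v (op false a b) =
     - ((-1) ^+ (k && (i (+) j)) *:
        op true (shift (-1) 1 (op false a b)) (shift 1 (-1) v)).
    have := br_skew (shift_even 0 (-1) gv) (shift_even (-1) 0 (op_even false ga gb)).
    by rewrite !(phiE, psiE, shift_shift).
  apply/(subspaceN sZ)/(subspaceZ sZ); rewrite shift_op.
  have := br_mul (shift_even (-1) 1 ga) (shift_even (-1) 1 gb) (shift_even 0 (-2) gv).
  rewrite !(phiE, psiE, shift_shift) /= => E; rewrite /op E.
  apply: subspaceD => //; first exact: (Z3 false true).
  by apply: subspaceZ => //; exact: (Z4 false true).
- have := br_mul (shift_even (-1) 0 gv) ga (shift_even (-1) 0 gb).
  rewrite !(phiE, psiE, shift_shift) /= => /eqP; rewrite -subr_eq => /eqP E.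
  apply: (eq_ind _ Z _ _ E).
  apply: subspaceB => //; first exact: (Z1 true false).
  by apply: subspaceZ => //; exact: (Z2 false true).
- have := mul_assoc P (shift (-1) 0 v) a b.
  rewrite !(phiE, psiE, shift_shift) /= => E.
  by have := Z1 false false; rewrite /op -E.
Qed.

End Rearrangement.

(** * Annihilators of saturated sets *)

Section Saturated.
Variable S : set dual.
Hypothesis satS : saturated S.

Local Notation c := (S `&` Lambda).

(** Products of A_a and A_b then have weight zero, that is, lie in H. *)
Definition zero_weight (a b : dual) : Prop := twist a (-1) 0 + twist b 0 (-1) = 0.

Lemma sat_pm a : S a -> pmLambda a. Proof. by case: satS => + _ _ _; apply. Qed.
Lemma sat_twist a p q : S a -> S (twist a p q).
Proof. by case: satS => _ + _ _; apply. Qed.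
Lemma satN a : S a -> S (- a). Proof. by case: satS => _ _ + _; apply. Qed.
Lemma satD a b : S a -> pmLambda b -> pmLambda (a + b) -> S (a + b).
Proof. by case: satS => _ _ _; apply. Qed.

Lemma twist_opp (a b : dual) p q p' q' :
  twist a p q + twist b p' q' = 0 -> a = - twist b (p' - p) (q' - q).
Proof.
move=> /eqP; rewrite addr_eq0 => /eqP /(congr1 (fun d => twist d (- p) (- q))).
by rewrite twistN !twist_twist !subrr twist00.
Qed.

Lemma zero_weightE a b : zero_weight a b -> b = - twist a (-1) 1.
Proof. by rewrite /zero_weight addrC => /twist_opp. Qed.

Lemma sat_partner a b : zero_weight a b -> S a <-> S b.
Proof.
move=> ab; split=> [Sa|Sb]; first by rewrite (zero_weightE ab); exact/satN/sat_twist.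
by rewrite (twist_opp ab); exact/satN/sat_twist.
Qed.

Lemma sat_root a x : S a -> root_space a x -> x <> 0 -> Lambda a.
Proof.
move=> Sa ax x0; have pa := sat_pm Sa.
by have [|/(pm_neq0 pa)|] := weight_cases (pm_scalar pa) ax.
Qed.

Lemma sat_root_space a d x : S a -> pmLambda d -> scalar (a + d) ->
  root_space (a + d) x -> [\/ x = 0, a + d = 0 | S (a + d) /\ Lambda (a + d)].
Proof.
move=> Sa pd ls adx; have [->|->|L] := weight_cases ls adx.
- by constructor 1.
- by constructor 2.
by constructor 3; split=> //; apply: satD => //; left.
Qed.

(** A root a in S is c(0,-1) for a root c in S, and then b = -c(-1,0), so these products
    are generators of H_S.  When a is not a root, its root space is zero. *)
Lemma op_class_H k a b x y : S a -> zero_weight a b ->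
  root_space a x -> root_space b y -> class_H c (op k x y).
Proof.
move=> Sa ab ax yb; have [->|x0] := EM (x = 0).
  by rewrite op0l; exact: subspace0 (subspace_sumS _ _).
have La := sat_root Sa ax x0.
apply: (@sub_sumS _ _ _ _ _ (twist a 0 1)).
  by split; [exact: sat_twist | exact: root_twist].
have xa : root_space (twist (twist a 0 1) 0 (-1)) x by rewrite twist_twist twist00.
have yb' : root_space (- twist (twist a 0 1) (-1) 0) y.
  by rewrite twist_twist; rewrite (zero_weightE ab) in yb.
case: k; [apply: addSl | apply: addSr]; try exact: subspace_lspan.
  by apply: sub_lspan; exists x => //; exists y.
by apply: sub_lspan; exists x => //; exists y.
Qed.

Lemma class_H_sub Z : subspace Z ->
  (forall k a b x y, S a -> S b -> zero_weight a b ->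
     root_space a x -> root_space b y -> Z (op k x y)) ->
  class_H c `<=` Z.
Proof.
move=> sZ opZ; apply: sumS_sub => // a [Sa La].
have ab : zero_weight (twist a 0 (-1)) (- twist a (-1) 0).
  by rewrite /zero_weight twistN !twist_twist subrr.
have Sa' := sat_twist 0 (-1) Sa; have Sb' := (sat_partner ab).1 Sa'.
by apply: addS_sub => //; apply: prodS_sub => // x y ax yb;
  [apply: (opZ true) ax yb | apply: (opZ false) ax yb].
Qed.

Lemma class_V_root a x : S a -> root_space a x -> class_V c x.
Proof.
move=> Sa ax; have [->|x0] := EM (x = 0); first exact: subspace0 (subspace_sumS _ _).
by apply: (@sub_sumS _ _ _ _ _ a) => //; split=> //; exact: sat_root Sa ax x0.
Qed.

Lemma subspace_class_H : subspace (class_H c). Proof. exact: subspace_sumS. Qed.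
Lemma subspace_class_V : subspace (class_V c). Proof. exact: subspace_sumS. Qed.
Lemma subspace_class_I : subspace (class_I c).
Proof. exact: subspace_addS subspace_class_H subspace_class_V. Qed.

Lemma class_H_root0 : class_H c `<=` root_space (0 : dual).
Proof.
apply: class_H_sub; first exact: subspace_root_space.
by move=> k a b x y _ _ ab ax yb; rewrite -ab; apply: root_space_op.
Qed.

Definition annihilator : set A := [set v | forall a x k,
  S a -> root_space a x -> op k x v = 0 /\ op k v x = 0].

Lemma subspace_annihilator : subspace annihilator.
Proof.
split=> [a x k _ _|l v w Nv Nw a x k Sa ax]; first by rewrite op0l op0r.
have [v1 v2] := Nv _ _ k Sa ax; have [w1 w2] := Nw _ _ k Sa ax.
by rewrite opDl opDr opZl opZr v1 v2 w1 w2 scaler0 addr0.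
Qed.

Lemma gr_direct_homog i x0 x1 :
  x0 \in gr i -> x1 \in gr (~~ i) -> x0 + x1 = 0 -> x0 = 0 /\ x1 = 0.
Proof.
by case: i => g0 g1; [rewrite addrC => /(gr_direct g1 g0) [] | exact: gr_direct].
Qed.

Lemma graded_annihilator : graded annihilator.
Proof.
move=> v Nv; have [v0 [v1 [g0 g1 E]]] := gr_split v.
suff N a k x : S a -> root_space a x ->
    (op k x v0 = 0 /\ op k x v1 = 0) /\ (op k v0 x = 0 /\ op k v1 x = 0).
  exists v0, v1; split=> // a x k Sa ax; first by have [[? _] [? _]] := N a k x Sa ax.
  by have [[_ ?] [_ ?]] := N a k x Sa ax.
move=> Sa; move: x.
apply: (@graded_ind _ (fun x => (op k x v0 = 0 /\ op k x v1 = 0) /\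
  (op k v0 x = 0 /\ op k v1 x = 0)) (@graded_root_space a)).
  move=> x y [[x1 x2] [x3 x4]] [[y1 y2] [y3 y4]].
  by rewrite !opDl !opDr x1 x2 x3 x4 y1 y2 y3 y4 !addr0.
move=> i x ax gx; have [N1 N2] := Nv _ _ k Sa ax; split.
  apply: (gr_direct_homog (i := i)); last by rewrite -opDr -E.
    by have := op_even k gx g0; rewrite addbF.
  by have := op_even k gx g1; rewrite addbT.
apply: (gr_direct_homog (i := i)); last by rewrite -opDl -E.
  by have := op_even k g0 gx.
by have := op_even k g1 gx.
Qed.

Lemma annihilator_shift p q v : annihilator v -> annihilator (shift p q v).
Proof.
move=> Nv a x k Sa ax; rewrite -[x](shiftNK p q) -!shift_op.
have [-> ->] := Nv _ _ k (sat_twist (- - p) (- - q) Sa) (root_space_shift (- p) (- q) ax).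
by rewrite shift_0.
Qed.

(** Every term in the rearrangements of the products contains a product of v, up to a
    twist, with an element of a root space of S. *)
Lemma annihilator_op_op a b x y v m n : S a -> S b ->
  root_space a x -> root_space b y -> annihilator v ->
  op m (op n x y) v = 0 /\ op m v (op n x y) = 0.
Proof.
move=> Sa Sb ax yb Nv; move: x ax.
apply: (@graded_ind _ (fun x => op m (op n x y) v = 0 /\ op m v (op n x y) = 0)
  (@graded_root_space a)).
  by move=> x x' [x1 x2] [x3 x4]; rewrite !(opDl, opDr) x1 x2 x3 x4 addr0.
move=> i x ax gx; move: y yb.
apply: (@graded_ind _ (fun y => op m (op n x y) v = 0 /\ op m v (op n x y) = 0)
  (@graded_root_space b)).
  by move=> y y' [y1 y2] [y3 y4]; rewrite !(opDl, opDr) y1 y2 y3 y4 addr0.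
move=> j y yb gy; move: v Nv.
apply: (@graded_ind _ (fun v => op m (op n x y) v = 0 /\ op m v (op n x y) = 0)
  graded_annihilator).
  by move=> v v' [v1 v2] [v3 v4]; rewrite !(opDl, opDr) v1 v2 v3 v4 addr0.
move=> k v Nv gv.
have kill p q p' q' d z l : S d -> root_space d z ->
    op l (shift p q z) (shift p' q' v) = 0 /\ op l (shift p' q' v) (shift p q z) = 0.
  move=> Sd dz; apply: (annihilator_shift p' q' Nv) (root_space_shift p q dz).
  exact: sat_twist.
have killx p q p' q' l := kill p q p' q' a x l Sa ax.
have killy p q p' q' l := kill p q p' q' b y l Sb yb.
have killx0 p' q' l : op l x (shift p' q' v) = 0 /\ op l (shift p' q' v) x = 0.
  exact: (killx 0 0).
have killy0 p' q' l : op l y (shift p' q' v) = 0 by have [] := killy 0 0 p' q' l.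
split.
  rewrite -[_ = 0]/([set 0] _).
  apply: (op_op_l (subspace_set0 _) gx gy gv) => {}m {}n.
  - by rewrite killy0 op0r.
  - by rewrite (killx0 _ _ _).1 op0l.
  - by rewrite (killy _ _ _ _ _).2 op0r.
  - by rewrite (killx _ _ _ _ _).2 op0r.
rewrite -[_ = 0]/([set 0] _).
apply: (op_op_r (subspace_set0 _) gx gy gv) => {}m {}n.
- by rewrite (killx0 _ _ _).2 op0l.
- by rewrite (killy _ _ _ _ _).2 op0l.
- by rewrite (killy _ _ _ _ _).1 op0r.
- by rewrite (killx _ _ _ _ _).1 op0l.
- by rewrite (killx _ _ _ _ _).2 op0r.
Qed.

Lemma annihilator_class_I x v m : class_I c x -> annihilator v ->
  op m x v = 0 /\ op m v x = 0.
Proof.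
move=> Ix Nv; move: x Ix.
have sZ : subspace [set x | op m x v = 0 /\ op m v x = 0].
  exact: subspace_setI (subspace_preimage (op_linearl m v) (subspace_set0 _))
    (subspace_preimage (op_linearr m v) (subspace_set0 _)).
apply: addS_sub => //.
  apply: class_H_sub => // k a b x y Sa Sb _ ax yb.
  exact: (annihilator_op_op m k Sa Sb ax yb Nv).
by apply: sumS_sub => // a [Sa _] x ax; exact: (Nv _ _ m Sa ax).
Qed.

(** If the product of a root space of S with that of b did not vanish, its weight
    would be zero or a root.  In the first case b is a twist of an element of S up to
    sign; in the second the weight is in S, and subtracting from it the contribution
    of S leaves a twist of b in S. *)
Lemma root_annihilator b : pmLambda b -> ~ S b -> root_space b `<=` annihilator.
Proof.
move=> pb nSb y yb a x k Sa ax.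
have aux p q p' q' z : root_space (twist a p q + twist b p' q') z -> z = 0.
  move=> zw.
  have pb' := pm_twist p' q' pb; have Sa' := sat_twist p q Sa.
  have [//|E|[Sw _]] := sat_root_space Sa' pb'
    (scalarD (pm_scalar (sat_pm Sa')) (pm_scalar pb')) zw.
    case: nSb; move: E; rewrite addrC => /twist_opp ->.
    exact/satN/sat_twist.
  case: nSb; suff Sb' : S (twist b p' q').
    by have := sat_twist (- p') (- q') Sb'; rewrite twist_twist !subrr twist00.
  have E : twist b p' q' = twist a p q + twist b p' q' + - twist a p q.
    by rewrite addrAC subrr add0r.
  by rewrite E; apply: satD; rewrite -?E //; exact/pmN/sat_pm.
split; first exact: aux (root_space_op k ax yb).
by apply: (aux 0 (-1) (-1) 0); rewrite addrC; exact: root_space_op.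
Qed.

(** * Saturated sets give ideals *)

(** The product has weight zero, or a weight in S, or vanishes; for d = 0 its weight is
    a twist of a. *)
Lemma op_class_I a d k x y : S a -> root_space a x -> root_space d y ->
  d = 0 \/ pmLambda d -> class_I c (op k x y) /\ class_I c (op k y x).
Proof.
move=> Sa ax dy dP.
have inV b z : S b -> root_space b z -> class_I c z.
  by move=> Sb bz; apply: addSr; [exact: subspace_class_H | exact: class_V_root bz].
case: dP => [d0|pd].
  have E1 := root_space_op k ax dy; have E2 := root_space_op k dy ax.
  split; apply: inV; [|exact: E1| |exact: E2]; rewrite d0 twist0 ?addr0 ?add0r;
    exact: sat_twist.
have sI := subspace_class_I.
have ls p q p' q' : scalar (twist a p q + twist d p' q').
  by apply: scalarD; apply/pm_scalar/pm_twist => //; exact: sat_pm.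
have Hin z : class_H c z -> class_I c z by apply/addSl/subspace_class_V.
split.
  have E := root_space_op k ax dy.
  have [->|ad|[Sw _]] := sat_root_space (sat_twist _ _ Sa) (pm_twist _ _ pd) (ls _ _ _ _) E.
  - exact: subspace0.
  - by apply: Hin; exact: op_class_H ax dy.
  - exact: inV E.
have E := root_space_op k dy ax; rewrite addrC in E.
have [->|ad|[Sw _]] := sat_root_space (sat_twist _ _ Sa) (pm_twist _ _ pd) (ls _ _ _ _) E.
- exact: subspace0.
- have da : zero_weight d a by rewrite /zero_weight addrC.
  by apply: Hin; apply: op_class_H dy ax => //; apply/(sat_partner da).
- exact: inV E.
Qed.

(** The terms of the rearrangements are again products of elements of root spaces of S:
    multiplying by v only twists a weight.  The total weight is zero, which puts them
    in H_S. *)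
Lemma op_class_H_root0 m x v : class_H c x -> root_space (0 : dual) v ->
  class_H c (op m x v) /\ class_H c (op m v x).
Proof.
have sH := subspace_class_H => Hx v0; move: x Hx.
apply: class_H_sub => [|n a b x y Sa _ ab ax yb].
  exact: subspace_setI (subspace_preimage (op_linearl m v) sH)
    (subspace_preimage (op_linearr m v) sH).
pose Q x y v := class_H c (op m (op n x y) v) /\ class_H c (op m v (op n x y)).
rewrite -/(Q x y v); move: x ax.
apply: (@graded_ind _ (fun x => Q x y v) (@graded_root_space a)).
  by move=> x x' [x1 x2] [x3 x4]; rewrite /Q !(opDl, opDr); split; apply: subspaceD.
move=> i x ax gx; move: y yb.
apply: (@graded_ind _ (fun y => Q x y v) (@graded_root_space b)).
  by move=> y y' [y1 y2] [y3 y4]; rewrite /Q !(opDl, opDr); split; apply: subspaceD.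
move=> j y yb gy; move: v v0.
apply: (@graded_ind _ (fun v => Q x y v) (@graded_root_space 0)).
  by move=> v v' [v1 v2] [v3 v4]; rewrite /Q !(opDl, opDr); split; apply: subspaceD.
move=> k v v0 gv; rewrite /Q.
have xs p q := root_space_shift p q ax.
have ys p q := root_space_shift p q yb.
have vs p q : root_space (0 : dual) (shift p q v) := root_space_shift p q v0.
have Sb := (sat_partner ab).1 Sa.
have bE := zero_weightE ab.
have Hin1 d e l z w : S d -> root_space d z -> root_space e w ->
  zero_weight d e -> class_H c (op l z w) by move=> Sd dz ew de; exact: op_class_H dz ew.
have Hin2 d e l z w : S e -> root_space d z -> root_space e w ->
  zero_weight d e -> class_H c (op l z w).
  by move=> Se dz ew de; exact: op_class_H ((sat_partner de).2 Se) de dz ew.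
have zw := (fun d : dual => addr0 d, fun d : dual => add0r d).
have zwB := (fun d : dual => subrr d, fun d : dual => addNr d).
split.
  apply: (op_op_l sH gx gy gv) => m' n'.
  - apply: Hin1 (sat_twist _ _ Sa) (xs _ _) (root_space_op n' yb (vs _ _)) _.
    by rewrite /zero_weight bE !(twistD, twistN, twist0, twist_twist) zw zwB.
  - apply: Hin2 (sat_twist _ _ Sb) (root_space_op n' ax (vs _ _)) (ys _ _) _.
    by rewrite /zero_weight bE !(twistD, twistN, twist0, twist_twist) zw zwB.
  - apply: Hin1 (sat_twist _ _ Sa) (xs _ _) (root_space_op n' (vs _ _) (ys _ _)) _.
    by rewrite /zero_weight bE !(twistD, twistN, twist0, twist_twist) zw zwB.
  - apply: Hin1 (sat_twist _ _ Sb) (ys _ _) (root_space_op n' (vs _ _) (xs _ _)) _.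
    by rewrite /zero_weight bE !(twistD, twistN, twist0, twist_twist) zw zwB.
apply: (op_op_r sH gx gy gv) => m' n'.
- apply: Hin2 (sat_twist _ _ Sb) (root_space_op n' (vs _ _) ax) (ys _ _) _.
  by rewrite /zero_weight bE !(twistD, twistN, twist0, twist_twist) zw zwB.
- apply: Hin2 (sat_twist _ _ Sa) (root_space_op n' (vs _ _) (ys _ _)) (xs _ _) _.
  by rewrite /zero_weight bE !(twistD, twistN, twist0, twist_twist) zw zwB.
- apply: Hin1 (sat_twist _ _ Sa) (xs _ _) (root_space_op n' (ys _ _) (vs _ _)) _.
  by rewrite /zero_weight bE !(twistD, twistN, twist0, twist_twist) zw zwB.
- apply: Hin2 (sat_twist _ _ Sb) (root_space_op n' (xs _ _) (vs _ _)) (ys _ _) _.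
  by rewrite /zero_weight bE !(twistD, twistN, twist0, twist_twist) zw zwB.
- apply: Hin1 (sat_twist _ _ Sb) (ys _ _) (root_space_op n' (vs _ _) (xs _ _)) _.
  by rewrite /zero_weight bE !(twistD, twistN, twist0, twist_twist) zw zwB.
Qed.

(** A product with a root space outside S vanishes; one with a root space of S, or with
    H, is covered by the two preceding lemmas, the product of H_S and a root space of S being read as a
    product of that root space with an element of weight zero. *)
Lemma class_I_op m x v : class_I c x ->
  class_I c (op m x v) /\ class_I c (op m v x).
Proof.
have sI := subspace_class_I.
have HI z : class_H c z -> class_I c z by apply/addSl/subspace_class_V.
have sQl := subspace_setI (subspace_preimage (op_linearl m _) sI)
    (subspace_preimage (op_linearr m _) sI).
have sQr x' := subspace_setI (subspace_preimage (op_linearr m x') sI)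
    (subspace_preimage (op_linearl m x') sI).
move=> Ix; move: v; apply: (weight_ind (sQr x)) => [v v0|d v Ld dv]; move: x Ix.
  apply: addS_sub; first exact: sQl.
    by move=> x /(op_class_H_root0 m) /(_ v0) [/HI ? /HI].
  apply: sumS_sub; first exact: sQl.
  move=> a [Sa _] x ax; exact: (op_class_I m Sa ax v0 (or_introl erefl)).
have pd : pmLambda d by left.
have [Sd|nSd] := EM (S d); last first.
  move=> x Ix; have [E1 E2] := annihilator_class_I m Ix (root_annihilator pd nSd dv).
  by rewrite /= E1 E2; split; exact: subspace0.
apply: addS_sub; first exact: sQl.
  move=> x /class_H_root0 x0.
  by have [] := op_class_I m Sd dv x0 (or_introl erefl).
apply: sumS_sub; first exact: sQl.
by move=> a [Sa _] x ax; exact: (op_class_I m Sa ax dv (or_intror pd)).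
Qed.

Lemma class_I_shift p q x : class_I c x -> class_I c (shift p q x).
Proof.
have sI := subspace_preimage (@shift_linear p q) subspace_class_I.
move: x; apply: addS_sub => //.
  apply: class_H_sub => // k a b x y Sa _ ab ax yb.
  apply/addSl; first exact: subspace_class_V.
  rewrite shift_op; apply: op_class_H (root_space_shift p q ax) (root_space_shift p q yb).
    exact: sat_twist.
  have := congr1 (fun d => twist d (- p) (- q)) ab.
  rewrite /zero_weight twistD !twist_twist.
  by rewrite (addrC (-1)) (addrC 0 (- q)) (addrC 0 (- p)) (addrC (-1) (- q)).
apply: sumS_sub => // a [Sa _] x ax.
apply: addSr; first exact: subspace_class_H.
exact: class_V_root (sat_twist _ _ Sa) (root_space_shift p q ax).
Qed.

Lemma graded_class_I : graded (class_I c).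
Proof.
apply: graded_addS; apply/graded_lspan/graded_bigcup => a _; last first.
  exact: graded_root_space.
by apply: graded_addS;
  [apply: (graded_prodS (b := true)) | apply: (graded_prodS (b := false))]; exact: graded_root_space.
Qed.

Lemma ideal_class_I : ideal P (class_I c).
Proof.
have sI := subspace_class_I.
split; first exact: graded_subspaceP sI graded_class_I.
- apply: addS_sub => //; first apply: addS_sub => //; apply: prodS_sub => // x y.
  + by move=> Ix _; have [] := class_I_op true y Ix.
  + by move=> Ix _; have [] := class_I_op false y Ix.
  + by move=> _ Iy; have [] := class_I_op false x Iy.
- apply/seteqP; split=> [_ [x Ix <-]|x Ix]; first exact: (class_I_shift 1 0).
  by exists (shift (-1) 0 x); [exact: class_I_shift | rewrite phiE shift_shift].
- apply/seteqP; split=> [_ [x Ix <-]|x Ix]; first exact: (class_I_shift 0 1).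
  by exists (shift 0 (-1) x); [exact: class_I_shift | rewrite psiE shift_shift].
Qed.

End Saturated.

(** The root spaces of S and those of S' annihilate each other.  Hence a root space of S
    annihilates those of S', so it annihilates H_S'; read the other way round, H_S'
    annihilates the root spaces of S. *)
Lemma disjoint_annihilator S S' : saturated S -> saturated S' ->
  (forall a, S a -> ~ S' a) -> class_I (S' `&` Lambda) `<=` annihilator S.
Proof.
move=> sS sS' dis; have sN := subspace_annihilator S.
have nSS' a : S' a -> ~ S a by move=> S'a Sa; exact: dis Sa S'a.
apply: addS_sub => //.
  apply: (class_H_sub sS') => // k a b x y Sa Sb _ ax yb d z m Sd dz.
  have Nz := root_annihilator sS' (sat_pm sS Sd) (dis _ Sd) dz.
  by have [] := annihilator_op_op sS' m k Sa Sb ax yb Nz.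
apply: sumS_sub => // a [Sa La].
exact: (root_annihilator sS (root_pm La) (nSS' _ Sa)).
Qed.

Lemma class_I_orthogonal S S' : saturated S -> saturated S' ->
  (forall a, S a -> ~ S' a) ->
  forall m x y, class_I (S `&` Lambda) x -> class_I (S' `&` Lambda) y ->
  op m x y = 0.
Proof.
move=> sS sS' dis m x y Ix /(disjoint_annihilator sS sS' dis) Ny.
by have [] := annihilator_class_I sS m Ix Ny.
Qed.

(** * Connections *)

Lemma sigma1 (s : seq dual) : sigma s 1 = nth 0 s 0.
Proof. by rewrite /sigma big_geq // addr0 subrr twist00. Qed.

(** In this recursive form a connection is a sequence of steps, each a twist by phi^-1
    followed by the addition of a root up to sign and twist. *)
Lemma sigmaS (s : seq dual) i : (0 < i)%N ->
  sigma s i.+1 = twist (sigma s i) (-1) 0 + twist (nth 0 s i) 0 (-1).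
Proof.
move=> i0; rewrite /sigma big_nat_recr //= subrr addrA twistD twist_twist.
have decr (j : int) : j - i.+1%:Z = j - i%:Z - 1 by rewrite intS opprD addrA addrAC.
rewrite decr addr0; congr (_ + _ + _).
elim/big_ind2: _ => [//|a b d e -> ->|j _]; first by rewrite twistD.
by rewrite twist_twist decr addr0.
Qed.

(** By induction along the connection all the partial sums lie in S. *)
Lemma saturated_connected S a b : saturated S -> S a -> pmLambda b ->
  connected a b -> S b.
Proof.
move=> sS Sa pb [[z1 [z2 [->|->]]]|[s [s2 spm [n [r s0]] sig [m [t sb]]]]].
- exact: sat_twist.
- exact/(satN sS)/(sat_twist sS).
have pbt : pmLambda (sigma s (size s)).
  by case: sb => ->; [|apply: pmN]; exact: pm_twist.
have Ssig i : (0 < i <= size s)%N -> S (sigma s i).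
  elim: i => [//|[|i] IH] /andP[_ i_s].
    by rewrite sigma1 s0; exact: sat_twist.
  have Si : S (sigma s i.+1) by apply: IH; rewrite /= ltnW.
  rewrite sigmaS //; apply: (satD sS); first exact: sat_twist.
    exact/pm_twist/spm.
  rewrite -sigmaS //; have [->//|ne] := eqVneq i.+2 (size s).
  by apply: sig; rewrite /= -ltnS prednK ?(ltnW s2) // ltn_neqAle ne.
have Ss : S (sigma s (size s)) by apply: Ssig; rewrite (ltnW s2) leqnn.
have Sbt : S (twist b (- m%:Z) (- t%:Z)).
  by case: sb Ss => -> // /(satN sS); rewrite opprK.
by have := sat_twist sS (- - m%:Z) (- - t%:Z) Sbt; rewrite twist_twist !subrr twist00.
Qed.

(** Connections including those of length one, whose end points differ by a twist
    and a sign, so that both clauses of connectedness are covered uniformly. *)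
Definition reached (a b : dual) : Prop := pmLambda b /\ exists s : seq dual,
  [/\ (0 < size s)%N, forall j, (j < size s)%N -> pmLambda (nth 0 s j),
      exists n r : nat, nth 0 s 0 = twist a (- n%:Z) (- r%:Z),
      forall i, (0 < i <= size s)%N -> pmLambda (sigma s i)
    & exists m t : nat, sigma s (size s) = twist b (- m%:Z) (- t%:Z) \/
                        sigma s (size s) = - twist b (- m%:Z) (- t%:Z)].

Lemma reached_refl a : pmLambda a -> reached a a.
Proof.
move=> pa; split=> //; exists [:: a]; split=> //.
- by case.
- by exists 0, 0; rewrite twist00.
- by case=> [|[|]] // _; rewrite sigma1.
- by exists 0, 0; left; rewrite sigma1 twist00.
Qed.

Lemma reached_connected a b : reached a b -> connected a b.
Proof.
move=> [pb [s [s0 spm [n [r sa]] sig [m [t sb]]]]].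
have [s1|s1] := eqVneq (size s) 1.
  left; exists (m%:Z - n%:Z), (t%:Z - r%:Z).
  rewrite s1 sigma1 sa in sb.
  have E d : d = twist b (- m%:Z) (- t%:Z) -> b = twist d m t.
    by move=> ->; rewrite twist_twist !addNr twist00.
  case: sb => [/E ->|sb]; [left|right].
    by rewrite twist_twist ![_ - _]addrC.
  have /E -> : - twist a (- n%:Z) (- r%:Z) = twist b (- m%:Z) (- t%:Z).
    by rewrite sb opprK.
  by rewrite twistN twist_twist ![_ - _]addrC.
right; exists s; split=> //; last by exists m, t.
- by rewrite ltn_neqAle eq_sym s1.
- by exists n, r.
- move=> i /andP[i1 i2]; apply: sig; rewrite (ltnW i1) (leq_trans i2) //; exact: leq_pred.
Qed.

Lemma sigma_rcons (s : seq dual) d i :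
  (0 < i <= size s)%N -> sigma (rcons s d) i = sigma s i.
Proof.
elim: i => [//|[|i] IH] /andP[_ i_s].
  by rewrite !sigma1 nth_rcons i_s.
by rewrite [LHS]sigmaS // [RHS]sigmaS // IH ?(ltnW i_s) // nth_rcons i_s.
Qed.

Lemma sigma_map p q (s : seq dual) i :
  (0 < i <= size s)%N ->
  sigma [seq twist a p q | a <- s] i = twist (sigma s i) p q.
Proof.
elim: i => [//|[|i] IH] /andP[_ i_s].
  by rewrite !sigma1 (nth_map 0).
rewrite [LHS]sigmaS // IH ?(ltnW i_s) // (nth_map 0) // (@sigmaS s i.+1) //.
rewrite twistD !twist_twist.
by rewrite ![p + _]addrC ![q + _]addrC.
Qed.

(** A twist of the end point is absorbed by twisting the whole list; the addition of d
    is performed by appending a twist of d to the list, up to sign. *)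
Lemma saturated_reached a : saturated (reached a).
Proof.
split=> [b []//|b p q|b [pb [s [s0 spm sa sig [m [t sb]]]]]|b d].
- move=> [pb [s [s0 spm [n [r sa]] sig [m [t sb]]]]]; split; first exact: pm_twist.
  (* Connections use only nonpositive twists of their end points, so p and q are
     compensated by twisting the list by -|p| and -|q|. *)
  exists [seq twist c (- (`|p|%N)%:Z) (- (`|q|%N)%:Z) | c <- s].
  rewrite size_map; split=> //.
  + by move=> j js; rewrite (nth_map 0) //; exact/pm_twist/spm.
  + exists (n + `|p|)%N, (r + `|q|)%N; rewrite (nth_map 0) // sa twist_twist.
    by rewrite !PoszD !opprD.
  + by move=> i i_s; rewrite sigma_map //; exact/pm_twist/sig.
  have abs_shift (x : int) (y : nat) : exists z : nat, z%:Z = x + y%:Z + `|x|%N%:Z.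
    by exists `|(x + y%:Z + `|x|%N%:Z)%R|%N; rewrite gez0_abs //; lia.
  have [m' Em] := abs_shift p m; have [t' Et] := abs_shift q t.
  exists m', t'; rewrite sigma_map ?s0 ?leqnn // Em Et.
  have E : twist (twist b p q) (- (p + m%:Z + `|p|%N%:Z)) (- (q + t%:Z + `|q|%N%:Z))
      = twist (twist b (- m%:Z) (- t%:Z)) (- (`|p|%N)%:Z) (- (`|q|%N)%:Z).
    by rewrite !twist_twist; congr (twist _ _ _); lia.
  by rewrite E; case: sb => ->; [left|right].
- split; first exact: pmN.
  exists s; split=> //; exists m, t; rewrite twistN opprK.
  by case: sb; [right | left].
- move=> [pb [s [s0 spm sa sig [m [t sb]]]]] pd pbd; split=> //.
  (* The appended entry e is chosen so that phi^-1 applied to the last sum, plus e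
     twisted by psi^-1, is a twist of b + d up to sign. *)
  have [e [pe se]] : exists e, pmLambda e /\
      (sigma s (size s) = twist b (- m%:Z) (- t%:Z) /\
         e = twist d (- m.+1%:Z) (1 - t%:Z) \/
       sigma s (size s) = - twist b (- m%:Z) (- t%:Z) /\
         e = - twist d (- m.+1%:Z) (1 - t%:Z)).
    case: sb => sb; first by exists (twist d (- m.+1%:Z) (1 - t%:Z)); split;
      [exact: pm_twist | left].
    by exists (- twist d (- m.+1%:Z) (1 - t%:Z)); split;
      [exact/pmN/pm_twist | right].
  have last_sigma : sigma (rcons s e) (size s).+1 = twist (b + d) (- m.+1%:Z) (- t%:Z) \/
      sigma (rcons s e) (size s).+1 = - twist (b + d) (- m.+1%:Z) (- t%:Z).
    rewrite sigmaS // sigma_rcons ?s0 ?leqnn // nth_rcons ltnn eqxx.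
    have Em : - m%:Z - 1 = - m.+1%:Z by rewrite intS opprD addrC.
    have Et : 1 - t%:Z - 1 = - t%:Z by rewrite addrAC subrr add0r.
    by case: se => -[-> ->]; [left|right];
      rewrite ?twistN !twist_twist !addr0 Em Et twistD ?opprD.
  exists (rcons s e); rewrite size_rcons; split=> //.
  + move=> j; rewrite ltnS leq_eqVlt nth_rcons => /orP[/eqP->|js].
      by rewrite ltnn eqxx.
    by rewrite js; exact: spm.
  + by have [n [r sa']] := sa; exists n, r; rewrite nth_rcons s0.
  + move=> i /andP[i0]; rewrite leq_eqVlt => /orP[/eqP->|i_s].
      by case: last_sigma => ->; [|apply: pmN]; exact: pm_twist.
    by rewrite sigma_rcons ?i0 //; apply: sig; rewrite i0.
  + by exists m.+1, t.
Qed.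

Lemma connectedE a b : pmLambda a -> pmLambda b -> connected a b <-> component a b.
Proof.
move=> pa pb; split=> [ab|[_ ab]].
  by split=> // S sS Sa; exact: saturated_connected ab.
exact/reached_connected/(ab _ (saturated_reached a))/reached_refl.
Qed.

Lemma root_classE a : Lambda a -> root_class a = component a `&` Lambda.
Proof.
move=> La; apply/seteqP; split=> b [].
  by move=> Lb /(connectedE (root_pm La) (root_pm Lb)).
by move=> ab Lb; split=> //; apply/(connectedE (root_pm La) (root_pm Lb)).
Qed.

End Weights.

(** * The decomposition *)

Section Decomposition.
Variables (K : fieldType) (A : lmodType K) (P : bihom_poisson_superalgebra A).
Variable H : submodClosed A.
Hypothesis splitP : split_regular P H.

Local Notation Lambda := (root_system P H).
Local Notation pmLambda := (@pm_root_system K A P H).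

(** The whole of Lambda and -Lambda is the saturated set that accounts for the span of
    all generators. *)
Lemma saturated_pm : saturated pmLambda.
Proof. by split=> // [a p q|a]; [exact: pm_twist | exact: pmN]. Qed.

Lemma class_H_sub_H S : saturated S -> class_H (S `&` Lambda) `<=` [set` H].
Proof. by move=> sS x /(class_H_root0 splitP sS) /(root_space0_H splitP). Qed.

Lemma class_H_roots_sub : class_H Lambda `<=` [set` H].
Proof.
have <- : pmLambda `&` Lambda = Lambda by apply/setIidr => a; left.
exact: class_H_sub_H saturated_pm.
Qed.

Lemma complement_sum U : is_complement U (class_H Lambda) [set` H] ->
  addS U (sumS (root_classes P H) class_I) = setT.
Proof.
move=> [/(subspace_submod U).2 sU _ UH].
have sI := subspace_sumS (root_classes P H) class_I.
have sQ := subspace_addS sU sI.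
have inclass a : Lambda a -> root_class a a.
  by move=> La; rewrite root_classE //; split=> //; apply/component_refl; left.
have I_class a : Lambda a -> class_I (root_class a) `<=` sumS (root_classes P H) class_I.
  by move=> La; apply: sub_sumS; exists a.
apply/seteqP; split=> // x _; move: x; apply: (weight_ind splitP sQ) => [x|a x La ax].
  move=> /(root_space0_H splitP) Hx; have : [set` H] x by [].
  rewrite -UH; apply: addS_sub => //; first exact: addSl.
  apply: sumS_sub => // a La y ay; apply: addSr => //; apply: (I_class a La).
  by apply: addSl; [exact: subspace_sumS | exact: sub_sumS (inclass a La) _ ay].
apply: addSr => //; apply: (I_class a La).
by apply: addSr; [exact: subspace_sumS | exact: sub_sumS (inclass a La) _ ax].
Qed.

Lemma indep_root_spaces c : c `<=` Lambda -> indep_family c root_space.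
Proof.
move=> cL a ca; have [_ _ ind _ _] := splitP.
apply/indep2E; [exact: subspace_root_space | exact: subspace_sumS |].
move=> x ax cx; apply: ((indep2E _ _).1 (ind a (cL _ ca)) x ax).
- exact: subspace_root_space.
- exact: subspace_sumS.
move: cx; apply: sumS_sub; first exact: subspace_sumS.
by move=> b [cb ba]; apply: sub_sumS; split=> //; exact: cL.
Qed.

Lemma indep_class_HV S : saturated S ->
  indep2 (class_H (S `&` Lambda)) (class_V (S `&` Lambda)).
Proof.
move=> sS; have [_ _ _ ind _] := splitP.
apply/indep2E; [exact: subspace_sumS | exact: subspace_sumS |].
move=> x /(class_H_sub_H sS) Hx Vx.
apply: ((indep2E _ _).1 ind x Hx).
- exact: subspace_of_submod.
- exact: subspace_sumS.
move: Vx; apply: sumS_sub; first exact: subspace_sumS.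
by move=> b [_ Lb]; apply: sub_sumS.
Qed.

Lemma class_I_op0 a b : Lambda a -> Lambda b -> root_class a <> root_class b ->
  forall m x y, class_I (root_class a) x -> class_I (root_class b) y ->
  op P m x y = 0.
Proof.
move=> La Lb; rewrite !root_classE // => ab m x y.
apply: (class_I_orthogonal splitP); try exact: saturated_component.
move=> d ad bd; apply: ab.
by rewrite (component_meet_eq splitP (root_pm La) (root_pm Lb) ad bd).
Qed.

End Decomposition.

Theorem theorem2p13 (K : fieldType) (A : lmodType K)
    (P : bihom_poisson_superalgebra A) (H : submodClosed A)
    (splitP : split_regular P H) :
  [/\ exists U : set A, is_complement U (class_H (root_system P H)) [set` H],
      forall U : set A, is_complement U (class_H (root_system P H)) [set` H] ->
        addS U (sumS (root_classes P H) class_I) = setT,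
      forall c, root_classes P H c ->
        [/\ indep_family c root_space, indep2 (class_H c) (class_V c)
          & ideal P (class_I c)]
    & forall c d, root_classes P H c -> root_classes P H d -> c <> d ->
        addS (brS P (class_I c) (class_I d))
             (mulS P (class_I c) (class_I d)) = [set 0]].
Proof.
split.
- apply: ex_complement; [exact: subspace_sumS | exact: subspace_of_submod |].
  exact: class_H_roots_sub.
- exact: complement_sum.
- move=> _ [a La <-]; rewrite root_classE //.
  have sat_a := saturated_component splitP a.
  split; first by apply: indep_root_spaces => // b [].
    exact: indep_class_HV.
  exact: ideal_class_I.
move=> _ _ [a La <-] [b Lb <-] ab.
have prod0 := class_I_op0 splitP La Lb ab.
apply/seteqP; split.
  apply: addS_sub; first exact: subspace_set0.
    apply: prodS_sub => [|x y Ix Iy]; first exact: subspace_set0.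
    exact: (prod0 true x y Ix Iy).
  apply: prodS_sub => [|x y Ix Iy]; first exact: subspace_set0.
  exact: (prod0 false x y Ix Iy).
move=> _ ->; apply: subspace0; apply: subspace_addS; exact: subspace_lspan.
Qed.
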